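(* Let $q$ be a prime power, let $\mathbb{F}_q$ be the field with $q$ elements, and let $F(x,y)$ be the free $\mathbb{F}_q$-algebra with two generators $x,y$ in a Nielsen–Schreier variety defined by a homogeneous system of polynomial identities, with $F(x,y)\neq 0$. Let $c_n$ be the dimension of the vector space of all homogeneous polynomials $u(x)$ of degree $n$ in the one variable $x$ in $F(x,y)$. (i) The number $p_n$ of automorphisms $\varphi=(f,g)$ of degree $n$ of $F(x,y)$ is given by the formulas \[ p_1=q^3(q-1)^2(q+1)\quad\text{for unitary algebras}, \] \[ p_1=q(q-1)^2(q+1)\quad\text{for nonunitary algebras}, \] \[ p_n=p_1(q+1)\sum q^{k-1}\prod_{i=1}^k\left((q^{c_{n_i}}-1)q^{c_2+\cdots+c_{n_i-1}}\right),\qquad n>1, \] where the summation is over all ordered factorizations $n=n_1\cdots n_k$ of $n$ with $n_1,\ldots,n_k>1$ (over all possible lengths $k\ge1$). (ii) The Dirichlet series generating function $p(s)=\sum_{n\ge1}\frac{p_n}{n^s}$ of the sequence $p_n$, $n=1,2,\ldots$, is \[ p(s)=\frac{p_1}{q}\left(\frac{q+1}{1-q\sigma(s)}-1\right), \] where \[ \sigma(s)=\sum_{n\geq 2}(q^{c_n}-1)q^{c_2+\cdots+c_{n-1}}\frac{1}{n^s}. \]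
   Context: A variety of algebras over a field $K$ is the class of all (possibly nonassociative) $K$-algebras satisfying a given system of polynomial identities. A variety satisfies the Nielsen–Schreier property (is a Nielsen–Schreier variety) if every subalgebra of a free algebra of the variety is again free in the same variety. The defining system of identities is homogeneous if it consists of identities homogeneous with respect to each variable; the free algebra $F(x,y)$ is then graded by degree in $x$ and $y$. One works either with unitary algebras (algebras with $1$, where $F(x,y)$ contains constants) or with nonunitary algebras (where $F(x,y)$ has no constant terms). An automorphism $\varphi$ of $F(x,y)$ (as an $\mathbb{F}_q$-algebra) is written $\varphi=(f,g)$, meaning $f=\varphi(x)$, $g=\varphi(y)$; its degree is $\max\{\deg(f),\deg(g)\}$, where $\deg$ is the total degree. An empty sum $c_2+\cdots+c_{m-1}$ (for $m=2$) is $0$. Dirichlet series are formal: $\sum_{n\ge1}a_n n^{-s}$ encodes the sequence $(a_n)_{n\ge1}$ of rational numbers, addition is coefficientwise, and multiplication is Dirichlet convolution (the coefficient at $n$ of a product is $\sum_{ij=n}a_ib_j$). A constant $c$ denotes the series with coefficient $c$ at $n=1$ and $0$ elsewhere. Since $\sigma(s)$ has zero coefficient at $n=1$, $1-q\sigma(s)$ is invertible in this ring. No convergence is claimed. *)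

(* Defs.v *)
From HB Require Import structures.
From mathcomp Require Import all_boot all_order all_algebra.
From mathcomp Require Import boolp classical_sets functions cardinality.

Set Implicit Arguments.
Unset Strict Implicit.
Unset Printing Implicit Defensive.

Import GRing.Theory.
Local Open Scope ring_scope.
Local Open Scope classical_set_scope.

(* Nonassociative algebras.  The flag u selects unitary (u = true) or nonunitary
   (u = false) algebras.  In the nonunitary case the distinguished element naone
   is forced to be 0, so that it carries no information: homomorphisms preserve
   it and subalgebras contain it for free. *)
HB.mixin Record Lmodule_isNAAlgebra (u : bool) (K : fieldType) A
    of GRing.Lmodule K A := {
  namul : A -> A -> A;
  naone : A;
  namulDl : left_distributive namul +%R;
  namulDr : right_distributive namul +%R;
  namulZl : forall (k : K) (a b : A), namul (k *: a) b = k *: namul a b;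
  namulZr : forall (k : K) (a b : A), namul a (k *: b) = k *: namul a b;
  naoneP : if u then left_id naone namul /\ right_id naone namul
           else naone = 0
}.

#[short(type="naAlgType")]
HB.structure Definition NAAlgebra (u : bool) (K : fieldType) :=
  { A of Lmodule_isNAAlgebra u K A & GRing.Lmodule K A }.

Arguments namul {u K s}.
Arguments naone {u K s}.

Definition is_hom (u : bool) (K : fieldType) (A B : naAlgType u K)
    (phi : A -> B) : Prop :=
  [/\ linear phi,
      forall a b, phi (namul a b) = namul (phi a) (phi b)
    & phi naone = naone].

(* Subalgebras.  Boolean predicates lose no generality, by classical logic. *)
Record subalgebra (u : bool) (K : fieldType) (A : naAlgType u K) := Subalgebra {
  subalg_pred :> {pred A};
  subalg_submod : submod_closed subalg_pred;
  subalg_mul : {in subalg_pred &, forall a b, namul a b \in subalg_pred};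
  subalg_one : naone \in subalg_pred
}.

Section SubalgebraAsAlgebra.
Variables (u : bool) (K : fieldType) (A : naAlgType u K) (S : subalgebra A).

HB.instance Definition _ :=
  GRing.isSubmodClosed.Build K A (subalg_pred S) (subalg_submod S).

Inductive subalg_type : predArgType :=
  SubalgElt (a : A) of a \in subalg_pred S.
Definition subalg_val (a : subalg_type) : A := let: SubalgElt a _ := a in a.

HB.instance Definition _ := [isSub of subalg_type for subalg_val].
HB.instance Definition _ := [Choice of subalg_type by <:].
HB.instance Definition _ := [SubChoice_isSubLmodule of subalg_type by <:].

Definition subalg_namul (a b : subalg_type) : subalg_type :=
  SubalgElt (subalg_mul (valP a) (valP b)).
Definition subalg_naone : subalg_type := SubalgElt (subalg_one S).

Fact subalg_namulDl : left_distributive subalg_namul +%R.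
Proof. by move=> a b c; apply: val_inj; rewrite /= namulDl. Qed.
Fact subalg_namulDr : right_distributive subalg_namul +%R.
Proof. by move=> a b c; apply: val_inj; rewrite /= namulDr. Qed.
Fact subalg_namulZl (k : K) (a b : subalg_type) :
  subalg_namul (k *: a) b = k *: subalg_namul a b.
Proof. by apply: val_inj; rewrite /= namulZl. Qed.
Fact subalg_namulZr (k : K) (a b : subalg_type) :
  subalg_namul a (k *: b) = k *: subalg_namul a b.
Proof. by apply: val_inj; rewrite /= namulZr. Qed.
Fact subalg_naoneP :
  if u then left_id subalg_naone subalg_namul /\
            right_id subalg_naone subalg_namul
  else subalg_naone = 0.
Proof.
have := @naoneP u K A; case: ifP => _ [].
  by move=> l r; split=> a; apply: val_inj; rewrite /= (l, r).
by move=> e; apply: val_inj; rewrite /= e.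
Qed.

HB.instance Definition _ := Lmodule_isNAAlgebra.Build u K subalg_type
  subalg_namulDl subalg_namulDr subalg_namulZl subalg_namulZr subalg_naoneP.

End SubalgebraAsAlgebra.

(* Nonassociative words, possibly with constant letters 1 (which evaluate to 0
   in nonunitary algebras). *)
Inductive word (X : Type) : Type :=
  | WOne
  | WVar of X
  | WMul of word X & word X.
Arguments WOne {X}.

Fixpoint wdeg (X : Type) (w : word X) : nat :=
  match w with
  | WOne => 0
  | WVar _ => 1
  | WMul w1 w2 => wdeg w1 + wdeg w2
  end.

Fixpoint wdeg_in (X : eqType) (v : X) (w : word X) : nat :=
  match w with
  | WOne => 0
  | WVar v' => v' == v
  | WMul w1 w2 => wdeg_in v w1 + wdeg_in v w2
  end.

(* A list of terms (k, w) stands for the nonassociative polynomial which is the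
   sum of the k w; different lists may represent the same polynomial. *)
Definition napoly (K : fieldType) (X : Type) : Type := seq (K * word X).

Fixpoint weval (u : bool) (K : fieldType) (A : naAlgType u K) (X : Type)
    (g : X -> A) (w : word X) : A :=
  match w with
  | WOne => naone
  | WVar v => g v
  | WMul w1 w2 => namul (weval g w1) (weval g w2)
  end.

Definition peval (u : bool) (K : fieldType) (A : naAlgType u K) (X : Type)
    (g : X -> A) (p : napoly K X) : A :=
  \sum_(t <- p) t.1 *: weval g t.2.

(* A system E of polynomial identities in the variables indexed by nat defines
   the variety of the algebras A such that satisfies E A. *)
Definition satisfies (u : bool) (K : fieldType) (E : set (napoly K nat))
    (A : naAlgType u K) : Prop :=
  forall p, E p -> forall a : nat -> A, peval a p = 0.

Definition homogeneous_system (K : fieldType) (E : set (napoly K nat)) : Prop :=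
  forall p, E p -> exists d : nat -> nat,
    forall v : nat, all (fun t => wdeg_in v t.2 == d v) p.

Definition free_on (u : bool) (K : fieldType) (E : set (napoly K nat))
    (X : Type) (F : naAlgType u K) (g : X -> F) : Prop :=
  satisfies E F /\
  forall (A : naAlgType u K) (h : X -> A), satisfies E A ->
    exists phi : F -> A,
      [/\ is_hom phi,
          forall v, phi (g v) = h v
        & forall psi : F -> A, is_hom psi -> (forall v, psi (g v) = h v) ->
            psi =1 phi].

Definition nielsen_schreier (u : bool) (K : fieldType)
    (E : set (napoly K nat)) : Prop :=
  forall (X : Type) (F : naAlgType u K) (g : X -> F), free_on E g ->
  forall S : subalgebra F,
    exists (Y : Type) (b : Y -> subalg_type S), free_on E b.

Definition pair_gen (T : Type) (x y : T) (i : 'I_2) : T :=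
  if i == ord0 then x else y.

(* The algebra generated by the g v is graded by the degrees in each of the
   generators: the multihomogeneous components of a relation are relations.  Over
   a finite field this does not follow from homogeneous_system: over F_2, the
   identity x(xx) = 0 has consequences with components that are not identities. *)
Definition multigraded (u : bool) (K : fieldType) (A : naAlgType u K)
    (X : finType) (g : X -> A) : Prop :=
  forall p : napoly K X, peval g p = 0 ->
  forall d : X -> nat,
    peval g [seq t <- p | [forall v, wdeg_in v t.2 == d v]] = 0.

Definition homog (u : bool) (K : fieldType) (A : naAlgType u K) (X : Type)
    (g : X -> A) (n : nat) : set A :=
  [set a | exists2 p : napoly K X, all (fun t => wdeg t.2 == n) p & a = peval g p].

(* In a graded algebra, a has degree n with respect to the generators g:
   the top nonzero homogeneous component of a has degree n. *)
Definition has_deg (u : bool) (K : fieldType) (A : naAlgType u K) (X : Type)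
    (g : X -> A) (a : A) (n : nat) : Prop :=
  exists c : nat -> A,
    [/\ forall i, homog g i (c i), a = \sum_(i < n.+1) c i & c n != 0].

Definition has_dim (K : fieldType) (V : lmodType K) (U : set V) (n : nat) : Prop :=
  exists e : 'I_n -> V,
    (forall v, U v <-> exists a : 'I_n -> K, v = \sum_i a i *: e i) /\
    (forall a : 'I_n -> K, \sum_i a i *: e i = 0 -> forall i, a i = 0).

Definition is_automorphism (u : bool) (K : fieldType) (A : naAlgType u K)
    (phi : A -> A) : Prop := is_hom phi /\ bijective phi.

Definition automorphisms_of_degree (u : bool) (K : fieldType)
    (A : naAlgType u K) (x y : A) (n : nat) : set (A -> A) :=
  [set phi | is_automorphism phi /\
    exists m1 m2 : nat, [/\ has_deg (pair_gen x y) (phi x) m1,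
      has_deg (pair_gen x y) (phi y) m2 & n = maxn m1 m2]].

(* The sum over the ordered factorizations n = n_1 ... n_k with all n_i > 1 and
   k >= 1; such n_i are at most n and such k are at most n. *)
Definition factorization_sum (q : nat) (c : nat -> nat) (n : nat) : nat :=
  (\sum_(1 <= k < n.+1)
    \sum_(t : k.-tuple 'I_n.+1 |
            all (fun m : 'I_n.+1 => 1 < m) t && (\prod_(m <- t) m == n))
      q ^ (k - 1) *
      \prod_(m <- t) ((q ^ c m - 1) * q ^ (\sum_(2 <= j < m) c j)))%N.

(* Formal Dirichlet series: a n is the coefficient at n^(-s) for n > 0, and the
   value a 0 is irrelevant. *)
Definition dseries := nat -> rat.
Definition deq (a b : dseries) : Prop := forall n, (0 < n)%N -> a n = b n.
Definition dconst (k : rat) : dseries := fun n => if n == 1%N then k else 0.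
Definition dsub (a b : dseries) : dseries := fun n => a n - b n.
Definition dmul (a b : dseries) : dseries :=
  fun n => \sum_(d <- divisors n) a d * b (n %/ d)%N.
(* w = a / b *)
Definition is_dquot (a b w : dseries) : Prop := deq (dmul w b) a.

Definition dsigma (q : nat) (c : nat -> nat) : dseries :=
  fun n => if (2 <= n)%N
           then ((q ^ c n - 1) * q ^ (\sum_(2 <= j < n) c j))%N%:R else 0.

(* Main.v *)
Require Import Defs.
From HB Require Import structures.
From mathcomp Require Import all_boot all_order all_algebra.
From mathcomp Require Import boolp classical_sets functions cardinality.
From mathcomp Require Import zify ring.

Set Implicit Arguments.
Unset Strict Implicit.
Unset Printing Implicit Defensive.

Import GRing.Theory.
Local Open Scope ring_scope.
Local Open Scope classical_set_scope.

(** Identify an automorphism with the pair [(f, g)] of the images of [x] and [y].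
    The count rests on the fact that all automorphisms are tame, in the following
    precise form ([aut_top_dependent], [aut_reduce1]): if [deg f <= deg g] and
    [deg g > 1], then the leading form of [g] is [h(fbar)] for a homogeneous
    polynomial [h] in one variable and the leading form [fbar] of [f], so that
    [g - h(f)] has smaller degree.

    If the leading forms of [f] and [g] satisfied no relation, the leading form of
    any [P(f, g)] would be a nonzero value of a part of [P], and [x] and [y] would not
    be of the form [P(f, g)] ([top_ev]).  So they satisfy a relation, and the
    Nielsen-Schreier property enters: two elements without constant terms generate a
    free subalgebra, and comparing them with its free generators shows that either
    they are themselves independent or a nontrivial linear combination of them is a
    combination of products of at least two of them ([free_or_linear_dependence]).
    For homogeneous elements a comparison of degrees turns the latter into
    [g = h(f)] ([homog_dependent]).

    Subtracting leading terms repeatedly, an automorphism with [deg f = a < b = deg g]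
    is written uniquely as [(f, g' + h(f))] with [deg g' <= a], where [h] has no
    constant and no linear term and has degree [b / a] ([aut_reduce]); there are
    [tails (b / a)] such [h].  Let [M a] be the number of automorphisms with
    [deg f = a >= deg g], and [D n] the number of those with [deg f < n = deg g].
    Then [D n] is the sum of the [tails (n / a) * M a] over the proper divisors [a] of
    [n].  If [deg f = deg g = n > 1], then the leading forms are proportional, whence
    [M n = q * D n], and [M n + D n = (q + 1) * D n] automorphisms have degree [n].
    Finally [M 1] is the number of affine automorphisms.  Unfolding this recursion
    gives the sum over ordered factorizations ([factorization_sum_rec]), and in terms
    of Dirichlet series it says that a series times [1 - q sigma(s)] is constant
    ([dirichlet_weight]). *)

(** * Spans of words in a nonassociative algebra *)

Lemma sum_by_key (V : nmodType) (T : Type) (X : eqType) (key : T -> X) (l : seq T)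
    (f : T -> V) :
  \sum_(t <- l) f t =
  \sum_(v <- undup [seq key t | t <- l]) \sum_(t <- l | key t == v) f t.
Proof.
rewrite (exchange_big_dep xpredT) //=.
have : {subset [seq key t | t <- l] <= undup [seq key t | t <- l]}.
  by move=> v; rewrite mem_undup.
have := undup_uniq [seq key t | t <- l].
move: (undup _) => r ur; elim: l => [|t l ih] sub; first by rewrite !big_nil.
rewrite !big_cons ih => [|v vl]; last by apply: sub; rewrite inE vl orbT.
congr (_ + _); rewrite -big_filter (eq_filter (a2 := pred1 (key t))).
  by rewrite filter_pred1_uniq ?big_seq1 // sub // inE eqxx.
by move=> v /=; rewrite eq_sym.
Qed.

Section Algebra.
Variables (u : bool) (K : fieldType).
Implicit Types A B C : naAlgType u K.

Lemma namul0r A (a : A) : namul 0 a = 0.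
Proof. by have := namulZl 0 0 a; rewrite !scale0r. Qed.

Lemma namulr0 A (a : A) : namul a 0 = 0.
Proof. by have := namulZr 0 a 0; rewrite !scale0r. Qed.

(** The two cases of unitary and nonunitary algebras, with the case distinction kept
    out of the types, which depend on [u]. *)
Lemma naone_unit_or_0 A :
  ((u%:R : K) = 1 /\ left_id (naone : A) namul /\ right_id (naone : A) namul) \/
  ((u%:R : K) = 0 /\ (naone : A) = 0).
Proof.
have split_if (b : bool) (P Q : Prop) :
  (if b then P else Q) -> ((b%:R : K) = 1 /\ P) \/ ((b%:R : K) = 0 /\ Q).
  by case: b => h; [left|right].
exact: split_if (@naoneP u K A).
Qed.

Lemma naone_mull A (a : A) : namul naone a = (u%:R : K) *: a.
Proof.
case: (naone_unit_or_0 A) => [[-> [l _]]|[-> ->]]; first by rewrite l scale1r.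
by rewrite namul0r scale0r.
Qed.

Lemma naone_mulr A (a : A) : namul a naone = (u%:R : K) *: a.
Proof.
case: (naone_unit_or_0 A) => [[-> [_ r]]|[-> ->]]; first by rewrite r scale1r.
by rewrite namulr0 scale0r.
Qed.

Lemma naoneM A : namul (naone : A) naone = naone.
Proof. by case: (naone_unit_or_0 A) => [[_ [-> _]]|[_ ->]]; rewrite ?namul0r. Qed.

Section Hom.
Variables (A B : naAlgType u K) (phi : A -> B).
Hypothesis hphi : is_hom phi.

Lemma hom_lin k a b : phi (k *: a + b) = k *: phi a + phi b.
Proof. by case: hphi => l _ _; rewrite l. Qed.
Lemma hom_mul a b : phi (namul a b) = namul (phi a) (phi b).
Proof. by case: hphi. Qed.
Lemma hom_one : phi naone = naone.
Proof. by case: hphi. Qed.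
Lemma hom_0 : phi 0 = 0.
Proof. by have := hom_lin (-1) 0 0; rewrite !scaleN1r !addNr. Qed.
Lemma hom_D a b : phi (a + b) = phi a + phi b.
Proof. by have := hom_lin 1 a b; rewrite !scale1r. Qed.
Lemma hom_Z k a : phi (k *: a) = k *: phi a.
Proof. by have := hom_lin k a 0; rewrite !addr0 hom_0 addr0. Qed.
Lemma hom_weval X (g : X -> A) w : phi (weval g w) = weval (phi \o g) w.
Proof.
by elim: w => [|v|w1 h1 w2 h2] //=; rewrite ?hom_one // hom_mul h1 h2.
Qed.
Lemma hom_peval X (g : X -> A) p : phi (peval g p) = peval (phi \o g) p.
Proof.
rewrite /peval; elim: p => [|t p ih]; first by rewrite !big_nil hom_0.
by rewrite !big_cons hom_lin ih hom_weval.
Qed.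
End Hom.

Lemma hom_id A : is_hom (@id A).
Proof. by split. Qed.

Lemma hom_comp A B C (f : B -> C) (g : A -> B) :
  is_hom f -> is_hom g -> is_hom (f \o g : A -> C).
Proof.
move=> hf hg; split=> [k a b|a b|] /=.
- by rewrite (hom_lin hg) (hom_lin hf).
- by rewrite (hom_mul hg) (hom_mul hf).
- by rewrite (hom_one hg) (hom_one hf).
Qed.

Section Peval.
Variables (A : naAlgType u K) (X : Type) (g : X -> A).

Lemma peval_cat p p' : peval g (p ++ p') = peval g p + peval g p'.
Proof. by rewrite /peval big_cat. Qed.

Definition pscale (k : K) (p : napoly K X) : napoly K X :=
  [seq (k * t.1, t.2) | t <- p].

Lemma peval_scale k p : peval g (pscale k p) = k *: peval g p.
Proof.
rewrite /peval big_map scaler_sumr; apply: eq_bigr => t _ /=.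
by rewrite scalerA.
Qed.

Lemma peval_word w : peval g [:: (1, w)] = weval g w.
Proof. by rewrite /peval big_seq1 scale1r. Qed.

Lemma peval_filter (P : pred (word X)) p :
  peval g p = peval g [seq t <- p | P t.2] + peval g [seq t <- p | ~~ P t.2].
Proof. by rewrite /peval !big_filter (bigID (fun t => P t.2)). Qed.

Definition wspan (P : pred (word X)) : set A :=
  [set a | exists2 p : napoly K X, all (fun t => P t.2) p & a = peval g p].

Lemma wspan_word (P : pred (word X)) w : P w -> wspan P (weval g w).
Proof. by move=> Pw; exists [:: (1, w)]; rewrite /= ?Pw // peval_word. Qed.

Lemma wspan0 P : wspan P 0.
Proof. by exists [::] => //; rewrite /peval big_nil. Qed.

Lemma wspanD P a b : wspan P a -> wspan P b -> wspan P (a + b).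
Proof.
move=> [p hp ->] [p' hp' ->]; exists (p ++ p'); last by rewrite peval_cat.
by rewrite all_cat hp hp'.
Qed.

Lemma wspanZ P k a : wspan P a -> wspan P (k *: a).
Proof.
move=> [p hp ->]; exists (pscale k p); last by rewrite peval_scale.
by rewrite all_map.
Qed.

Lemma wspanS (P Q : pred (word X)) a :
  (forall w, P w -> Q w) -> wspan P a -> wspan Q a.
Proof. by move=> PQ [p hp ->]; exists p => //; apply: sub_all hp => t; apply: PQ. Qed.

Lemma wspan_ind (P : pred (word X)) (Phi : A -> Prop) :
  Phi 0 -> (forall k a b, Phi a -> Phi b -> Phi (k *: a + b)) ->
  (forall w, P w -> Phi (weval g w)) -> forall a, wspan P a -> Phi a.
Proof.
move=> h0 hl hw a [p hp ->]; elim: p hp => [|t p ih]; first by rewrite /peval big_nil.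
by rewrite /peval big_cons => /= /andP[ht hp]; apply: hl (ih hp); apply: hw.
Qed.

Lemma wspanM (P Q R : pred (word X)) a b :
  (forall w w', P w -> Q w' -> R (WMul w w')) ->
  wspan P a -> wspan Q b -> wspan R (namul a b).
Proof.
move=> PQR ha hb; move: a ha; apply: wspan_ind.
- by rewrite namul0r; apply: wspan0.
- move=> k a a' ha ha'; rewrite namulDl namulZl.
  by apply: wspanD ha'; apply: wspanZ.
move=> w Pw; move: b hb; apply: wspan_ind.
- by rewrite namulr0; apply: wspan0.
- move=> k a a' ha ha'; rewrite namulDr namulZr.
  by apply: wspanD ha'; apply: wspanZ.
by move=> w' Qw'; apply: (@wspan_word R (WMul w w')); apply: PQR.
Qed.

Lemma wspan_split (P Q : pred (word X)) a : wspan Q a ->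
  exists b c, [/\ wspan (fun w => Q w && P w) b,
    wspan (fun w => Q w && ~~ P w) c & a = b + c].
Proof.
move=> [p hp ->].
exists (peval g [seq t <- p | P t.2]), (peval g [seq t <- p | ~~ P t.2]).
split; last exact: peval_filter.
- eexists => //; rewrite all_filter; apply: sub_all hp => t /= ->.
  by case: (P t.2).
- eexists => //; rewrite all_filter; apply: sub_all hp => t /= ->.
  by case: (P t.2).
Qed.

Lemma weval_deg0 w : wdeg w = 0%N -> weval g w = naone.
Proof.
elim: w => //= w1 h1 w2 h2 /eqP; rewrite addn_eq0 => /andP[/eqP e1 /eqP e2].
by rewrite h1 // h2 // naoneM.
Qed.

Lemma weval_deg1 w : wdeg w = 1%N -> exists k v, weval g w = k *: g v.
Proof.
elim: w => //= [v _|w1 h1 w2 h2]; first by exists 1, v; rewrite scale1r.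
case e1: (wdeg w1) => [|[|n]] // => [e2|[e2]].
- have [k [v e]] := h2 e2; exists (u%:R * k), v.
  by rewrite (weval_deg0 e1) naone_mull e scalerA.
- have [k [v e]] := h1 e1; exists (u%:R * k), v.
  by rewrite (weval_deg0 e2) naone_mulr e scalerA.
Qed.

Lemma wspan_deg0 (P : pred (word X)) a :
  (forall w, P w -> wdeg w = 0%N) -> wspan P a -> exists k, a = k *: naone.
Proof.
move=> P0; move: a; apply: wspan_ind.
- by exists 0; rewrite scale0r.
- by move=> k _ _ [k1 ->] [k2 ->]; exists (k * k1 + k2); rewrite scalerDl scalerA.
- by move=> w /P0 /weval_deg0 ->; exists 1; rewrite scale1r.
Qed.

Lemma wspan_deg1 (P : pred (word X)) a :
  (forall w, P w -> wdeg w = 1%N) -> wspan P a ->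
  exists l : seq (K * X), a = \sum_(t <- l) t.1 *: g t.2.
Proof.
move=> P1; move: a; apply: wspan_ind.
- by exists [::]; rewrite big_nil.
- move=> k _ _ [l1 ->] [l2 ->]; exists ([seq (k * t.1, t.2) | t <- l1] ++ l2).
  rewrite big_cat big_map scaler_sumr /=; congr (_ + _).
  by apply: eq_bigr => t _; rewrite scalerA.
- by move=> w /P1 /weval_deg1 [k [v ->]]; exists [:: (k, v)]; rewrite big_seq1.
Qed.

End Peval.

Lemma wspan_hom A B X (phi : A -> B) (g : X -> A) P a :
  is_hom phi -> wspan g P a -> wspan (phi \o g) P (phi a).
Proof. by move=> hphi [p hp ->]; exists p => //; rewrite (hom_peval hphi). Qed.

(** Substitution does not lower degrees: each letter of a word is replaced by a
    combination of words with at least one letter. *)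
Lemma wspan_ge_subst A X Y (g : X -> A) (b : Y -> A) n :
  (forall v, wspan g (fun w => 1 <= wdeg w)%N (b v)) ->
  forall a, wspan b (fun w => n <= wdeg w)%N a -> wspan g (fun w => n <= wdeg w)%N a.
Proof.
move=> hb; apply: wspan_ind; first exact: wspan0.
  by move=> k a a' ha ha'; apply: wspanD ha'; apply: wspanZ.
have hw w : wspan g (fun w' => wdeg w <= wdeg w')%N (weval b w).
  elim: w => [|v|w1 h1 w2 h2]; [exact: (@wspan_word _ _ g _ WOne)|exact: hb|].
  by apply: wspanM h1 h2 => w w' /= l1 l2; apply: leq_add.
by move=> w hn; apply: wspanS (hw w) => w'; apply: leq_trans.
Qed.

Lemma collect0 A (X : eqType) (g : X -> A) (l : seq (K * X)) :
  (forall v, \sum_(t <- l | t.2 == v) t.1 = 0) -> \sum_(t <- l) t.1 *: g t.2 = 0.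
Proof.
move=> h; rewrite (sum_by_key snd) big1 // => v _.
rewrite (eq_bigr (fun t => t.1 *: g v)) => [|t /eqP -> //].
by rewrite -scaler_suml h scale0r.
Qed.

Section Free.
Variables (E : set (napoly K nat)).

Lemma hom_satisfies A B (phi : A -> B) :
  is_hom phi -> injective phi -> satisfies E B -> satisfies E A.
Proof.
move=> hphi inj hB p Ep a; apply: inj.
by rewrite (hom_peval hphi) hB // (hom_0 hphi).
Qed.

Section SubalgebraOfPredicate.
Variables (A : naAlgType u K) (P : A -> Prop).
Hypotheses (P0 : P 0) (Pl : forall k a b, P a -> P b -> P (k *: a + b))
  (PM : forall a b, P a -> P b -> P (namul a b)) (P1 : P naone).

Definition subalg_of_pred : pred A := fun a => `[< P a >].

Lemma subalg_of_submod : submod_closed subalg_of_pred.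
Proof.
split; first by rewrite unfold_in; apply/asboolP.
move=> k a b; rewrite !unfold_in => /asboolP ha /asboolP hb.
by apply/asboolP; apply: Pl.
Qed.

Lemma subalg_of_mul :
  {in subalg_of_pred &, forall a b, namul a b \in subalg_of_pred}.
Proof.
move=> a b; rewrite !unfold_in => /asboolP ha /asboolP hb.
by apply/asboolP; apply: PM.
Qed.

Lemma subalg_of_one : naone \in subalg_of_pred.
Proof. by rewrite unfold_in; apply/asboolP. Qed.

Definition subalg_of : subalgebra A :=
  Subalgebra subalg_of_submod subalg_of_mul subalg_of_one.

Lemma subalg_ofP a : reflect (P a) (a \in subalg_of).
Proof. by rewrite unfold_in; apply: asboolP. Qed.

End SubalgebraOfPredicate.

Lemma val_hom A (S : subalgebra A) : is_hom (val : subalg_type S -> A).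
Proof. by split. Qed.

(** The universal property yields a retraction onto the subalgebra generated by the
    [g v]; by uniqueness it is the identity. *)
Lemma free_gen A X (g : X -> A) : free_on E g -> forall a, wspan g predT a.
Proof.
move=> [satA univ].
have l k a b : wspan g predT a -> wspan g predT b -> wspan g predT (k *: a + b).
  by move=> ha hb; apply: wspanD hb; apply: wspanZ.
have m a b : wspan g predT a -> wspan g predT b -> wspan g predT (namul a b).
  exact: wspanM.
have o : wspan g predT naone by apply: (@wspan_word _ _ g predT WOne).
pose S := subalg_of (wspan0 g predT) l m o.
have gS v : g v \in S by apply/(subalg_ofP _ l m o); apply: (@wspan_word _ _ g predT (WVar v)).
have satS : satisfies E (subalg_type S).
  exact: hom_satisfies (val_hom S) val_inj satA.
have [phi [hphi phig _]] := univ (subalg_type S) (fun v => SubalgElt (gS v)) satS.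
have [id' [_ _ uniq]] := univ A g satA.
move=> a; have e1 : val (phi a) = id' a.
  apply: (uniq (val \o phi)) => [|v /=]; last by rewrite phig.
  exact: hom_comp (val_hom S) hphi.
have e2 : a = id' a by apply: (uniq id) => //; apply: hom_id.
rewrite e2 -e1; case: (phi a) => b hb; exact: (elimT (subalg_ofP _ l m o b) hb).
Qed.

End Free.
End Algebra.

(** * Counting *)

Definition ncard (T : eqType) (A : set T) (n : nat) : Prop :=
  exists s : seq T, [/\ uniq s, size s = n & forall a, A a <-> a \in s].

Section NCard.
Implicit Types T U : eqType.


Lemma ncard_bij T U (f : T -> U) (A : set T) (B : set U) n :
  (forall a, A a -> B (f a)) ->
  (forall a a', A a -> A a' -> f a = f a' -> a = a') ->
  (forall b, B b -> exists2 a, A a & f a = b) ->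
  ncard A n -> ncard B n.
Proof.
move=> fB inj surj [s [us <- hs]]; exists [seq f a | a <- s]; split.
- by rewrite map_inj_in_uniq // => a a' /hs ha /hs ha'; apply: inj.
- by rewrite size_map.
move=> b; split=> [/surj[a /hs ha <-]|/mapP[a /hs ha ->]]; first exact: map_f.
exact: fB.
Qed.

Lemma ncard_eq T (A B : set T) n : (forall a, A a <-> B a) -> ncard A n -> ncard B n.
Proof.
move=> e; apply: (@ncard_bij T T id) => // [a /e //|b /e hb].
by exists b.
Qed.

Lemma ncard_empty T (A : set T) : (forall a, ~ A a) -> ncard A 0.
Proof. by move=> h; exists [::]; split=> // a; split=> // /h. Qed.

Lemma ncard_prod T U (A : set T) (B : set U) m n : ncard A m -> ncard B n ->
  ncard (fun ab : T * U => A ab.1 /\ B ab.2) (m * n).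
Proof.
move=> [s [us <- hs]] [r [ur <- hr]].
exists [seq (a, b) | a <- s, b <- r]; split.
- by apply: allpairs_uniq => // -[a b] [a' b'].
- by rewrite size_allpairs.
move=> [a b] /=; split=> [[/hs ha /hr hb]|/allpairsP[[a' b'] /= [/hs ha /hr hb [-> ->]]]] //.
by apply/allpairsP; exists (a, b).
Qed.

Lemma ncardU T (A B : set T) m n : (forall a, A a -> B a -> False) ->
  ncard A m -> ncard B n -> ncard (fun a => A a \/ B a) (m + n).
Proof.
move=> dis [s [us <- hs]] [r [ur <- hr]]; exists (s ++ r); split.
- rewrite cat_uniq us ur andbT; apply/hasPn => a /hr hb; apply/negP => /hs ha.
  exact: dis ha hb.
- by rewrite size_cat.
move=> a; rewrite mem_cat; split=> [[/hs ->|/hr ->]|/orP[/hs|/hr]]; rewrite ?orbT //.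
  by left.
by right.
Qed.

Lemma ncard_bigU T (A : nat -> set T) (k : nat -> nat) n :
  (forall i, (i < n)%N -> ncard (A i) (k i)) ->
  (forall i j a, A i a -> A j a -> i = j) ->
  ncard (fun a => exists2 i, (i < n)%N & A i a) (\sum_(0 <= i < n) k i).
Proof.
move=> hA dis; elim: n hA => [|n ih] hA.
  by rewrite big_nil; apply: ncard_empty => a [].
rewrite big_nat_recr //=.
apply: ncard_eq (ncardU _ (ih _) (hA n _)) => [a|a [i lt ha] hb||] //.
- split=> [[[i lt ha]|ha]|[i]]; [by exists i => //; apply: ltnW|by exists n|].
  rewrite ltnS leq_eqVlt => /orP[/eqP ->|lt] ha; first by right.
  by left; exists i.
- by rewrite (dis _ _ _ ha hb) ltnn in lt.
- by move=> i lt; apply: hA; apply: ltnW.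
Qed.

Lemma ncardD1 T (A : set T) a0 n : A a0 -> ncard A n ->
  ncard (fun a => A a /\ a != a0) (n - 1).
Proof.
move=> h0 [s [us <- hs]]; exists (rem a0 s); split; first exact: rem_uniq.
  by rewrite size_rem ?subn1 //; apply/hs.
move=> a; rewrite mem_rem_uniq // inE; split=> [[/hs -> ->]|/andP[ne /hs]] //.
Qed.

Lemma ncard_fin (T : finType) (P : {pred T}) : ncard (fun a : T => a \in P) #|P|.
Proof.
by exists (enum P); split=> [||a]; rewrite ?enum_uniq ?cardE ?mem_enum.
Qed.

End NCard.

Lemma ncard_has_dim (K : finFieldType) (V : lmodType K) (U : set V) n :
  has_dim U n -> ncard U (#|K| ^ n).
Proof.
move=> [e [span indep]].
rewrite -[X in (_ ^ X)%N](card_ord n) -card_ffun.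
apply: (ncard_bij (f := fun a : {ffun 'I_n -> K} => \sum_i a i *: e i))
  (ncard_fin _) => [a _|a a' _ _ /eqP|v /span[a ->]].
- by apply/span; exists a.
- rewrite -subr_eq0 -sumrB (eq_bigr (fun i => (a i - a' i) *: e i)); last first.
    by move=> i _; rewrite scalerBl.
  move=> /eqP h; apply/ffunP => i; apply/eqP; rewrite -subr_eq0.
  by have -> := indep _ h i.
- exists [ffun i => a i]; first by rewrite inE.
  by apply: eq_bigr => i _; rewrite ffunE.
Qed.

Lemma det_mx22 (R : comPzRingType) (A : 'M[R]_2) :
  \det A = A 0 0 * A 1 1 - A 0 1 * A 1 0.
Proof.
rewrite (expand_det_row A 0) !big_ord_recl big_ord0 addr0 /cofactor !det_mx11 !mxE.
rewrite -[lift 0 0](_ : 1 = _) //; last exact: val_inj.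
rewrite -[lift 1 0](_ : 0 = _) //; last exact: val_inj.
by rewrite expr0 expr1 mul1r mulN1r mulrN.
Qed.

(** The matrix [(k, l; m, n)] is encoded as [((k, l), (m, n))]. *)
Lemma ncard_det2 (K : finFieldType) :
  ncard (fun v : K * K * (K * K) => v.1.1 * v.2.2 - v.1.2 * v.2.1 != 0)
    (#|K| * (#|K| - 1) ^ 2 * (#|K| + 1)).
Proof.
rewrite subn1 addn1 -card_GL_2.
apply: (ncard_bij (f := fun A : {'GL_2[K]} => let M := GLval A in
   ((M 0 0, M 0 1), (M 1 0, M 1 1)))) (ncard_fin _) => /= [A _|A B _ _ [e1 e2 e3 e4]|].
- by rewrite -det_mx22 -unitfE; apply: (valP A).
- apply: val_inj; apply/matrixP => i j /=.
  have o2 (k : 'I_2) : k = 0 \/ k = 1.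
    by case: k => [[|[|]]] // lt; [left|right]; apply: val_inj.
  by case: (o2 i) => ->; case: (o2 j) => ->.
move=> [[k l] [m n]] /= d.
pose M : 'M[K]_2 := \matrix_(i, j)
  if i == 0 then if j == 0 then k else l else if j == 0 then m else n.
have uM : M \in unitmx by rewrite unitmxE unitfE det_mx22 !mxE.
exists (FinRing.unit 'M[K]_2 uM); first by rewrite inE.
by rewrite !mxE.
Qed.

(** * Ordered factorizations and Dirichlet series *)

Section Divisors.
Local Open Scope nat_scope.

Lemma big_divisors n N (P : pred nat) (F : nat -> nat) :
  (0 < n)%N -> (n < N)%N ->
  \sum_(d <- divisors n | P d) F d = \sum_(0 <= d < N | (d %| n) && P d) F d.
Proof.
move=> n0 nN; rewrite big_mkcondr /= -[RHS]big_filter [LHS]big_mkcond /=.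
apply: perm_big; apply: uniq_perm; rewrite ?divisors_uniq ?filter_uniq ?iota_uniq //.
move=> d; rewrite mem_filter mem_index_iota -dvdn_divisors //=.
case dv: (d %| n) => //=; apply/esym; exact: leq_ltn_trans (dvdn_leq n0 dv) nN.
Qed.

Lemma big_proper_divisors n (F : nat -> nat) : 0 < n ->
  \sum_(d <- divisors n | d < n) F d =
  \sum_(0 <= d < n) if (0 < d) && (d %| n) then F d else 0.
Proof.
move=> n0; rewrite (big_divisors _ _ n0 (ltnSn n)) [LHS]big_mkcond.
rewrite big_nat_recr //= ltnn andbF addn0 !big_nat; apply: eq_bigr => d /andP[_ lt].
by rewrite lt andbT; case: d lt => // lt; rewrite dvd0n (gtn_eqF n0).
Qed.

Lemma perm_codivisors n : (0 < n)%N ->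
  perm_eq (divisors n) [seq (n %/ d)%N | d <- divisors n].
Proof.
move=> n0; have inv d : d \in divisors n -> (n %/ (n %/ d) = d)%N.
  by rewrite -dvdn_divisors // => dv; rewrite divnA // mulKn.
have mem d : d \in divisors n -> (n %/ d)%N \in divisors n.
  by rewrite -!dvdn_divisors //; apply: dvdn_div.
apply: uniq_perm; rewrite ?divisors_uniq // ?map_inj_in_uniq ?divisors_uniq //.
  by move=> d d' hd hd' e; rewrite -[d]inv // e inv.
move=> d; apply/idP/mapP => [hd|[d' hd' ->]]; last exact: mem.
by exists (n %/ d)%N; rewrite ?inv // mem.
Qed.

End Divisors.

Lemma dmul_dconst k (b : dseries) n : (0 < n)%N -> dmul (dconst k) b n = k * b n.
Proof.
move=> n0; rewrite /dmul (bigD1_seq 1%N) ?divisors_uniq -?dvdn_divisors //=.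
rewrite divn1 /dconst eqxx big1 ?addr0 // => d /negPf ->.
by rewrite mul0r.
Qed.

Section Factorizations.
Variables (q : nat) (c : nat -> nat).

Section Nat.
Local Open Scope nat_scope.

(** The number of polynomials of degree [m] in one variable without constant and
    linear terms. *)
Definition tails m := (q ^ c m - 1) * q ^ (\sum_(2 <= j < m) c j).

(** The sum of the products [tails m_1 * ... * tails m_k] over the ordered
    factorizations [n = m_1 ... m_k] with all [m_i > 1]; in the recursion [a] is the
    product of all factors but one. *)
Fixpoint fact_sum k n : nat :=
  if k is k'.+1 then \sum_(a <- divisors n | a < n) tails (n %/ a) * fact_sum k' a
  else n == 1.

Lemma fact_sum_head k n : 0 < n ->
  fact_sum k.+1 n = \sum_(m <- divisors n | 1 < m) tails m * fact_sum k (n %/ m).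
Proof.
move=> n0 /=; rewrite (perm_big _ (perm_codivisors n0)) big_map /=.
rewrite big_seq_cond [RHS]big_seq_cond; apply: eq_big => [m|m /andP[]].
  rewrite -dvdn_divisors //; case dv: (m %| n) => //=.
  have := divnK dv; case: m dv => [|[|m]] dv e; nia.
rewrite -dvdn_divisors // => dv _; rewrite divnA // mulKn //.
Qed.

(** The bound [N] is independent of [n]: the induction on [k] replaces [n] by a
    divisor while the type of the factors has to stay the same. *)
Lemma fact_sum_tuple N k n : 0 < n <= N ->
  \sum_(t : k.-tuple 'I_N.+1 |
      all (fun m : 'I_N.+1 => 1 < m) t && (\prod_(m <- t) m == n))
    \prod_(m <- t) tails m = fact_sum k n.
Proof.
elim: k n => [|k ih] n /andP[n0 nN].
  transitivity (\sum_(t : 0.-tuple 'I_N.+1 | n == 1) 1).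
    apply: eq_big => [t|t _]; rewrite tuple0 ?big_nil //=; exact: eq_sym.
  rewrite /=; case: (n == 1); last by rewrite big_pred0.
  by rewrite (big_pred1 [tuple]) // => -[[|? ?] ?] //.
rewrite fact_sum_head // (@big_divisors n N.+1) // big_mkord.
pose f (p : 'I_N.+1 * k.-tuple 'I_N.+1) := [tuple of p.1 :: p.2].
rewrite (reindex f) /=; last first.
  exists (fun t => (thead t, [tuple of behead t])) => [[m t] _|t _] /=.
    by rewrite /f /= theadE; congr pair; apply: val_inj.
  by rewrite /f /= [RHS]tuple_eta; apply: val_inj.
rewrite (eq_bigl (fun p : 'I_N.+1 * k.-tuple 'I_N.+1 => ((p.1 %| n) && (1 < p.1)) &&
   (all (fun m : 'I_N.+1 => 1 < m) p.2 && (\prod_(m <- p.2) m == n %/ p.1)))); last first.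
  move=> [m t]; rewrite /f /= big_cons; case m1: (1 < m); rewrite ?andbF //=.
  case: (all _ _); rewrite ?andbF //= !andbT.
  apply/eqP/andP => [<-|[dv /eqP ->]]; last by rewrite mulnC divnK.
  by rewrite dvdn_mulr // mulKn ?eqxx // ltnW.
rewrite -(pair_big_dep (fun m : 'I_N.+1 => (m %| n) && (1 < m))
  (fun m t => all (fun m : 'I_N.+1 => 1 < m) (tval t) && (\prod_(m <- tval t) m == n %/ m))
  (fun m t => \prod_(m <- tval (f (m, t))) tails m)) /=.
apply: eq_bigr => m /andP[dv m1]; rewrite -ih.
  by rewrite big_distrr /=; apply: eq_bigr => t _; rewrite big_cons.
by rewrite divn_gt0 ?(ltnW m1) // dvdn_leq // (leq_trans (leq_div _ _)).
Qed.

(** At most [n - 1] factors greater than 1 can have the product [n]. *)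
Lemma fact_sum_big k n : 0 < n <= k -> fact_sum k n = 0.
Proof.
elim: k n => [|k ih] n /andP[n0 nk]; first by case: n n0 nk.
rewrite /= big_seq_cond big1 // => a /andP[]; rewrite -dvdn_divisors // => dv lt.
rewrite ih ?muln0 // (dvdn_gt0 n0 dv) -ltnS; exact: leq_trans lt nk.
Qed.

(** Counting the empty factorization of 1 as well makes the recursion below uniform. *)
Definition weight n := (n == 1) + q * factorization_sum q c n.

Lemma factorization_sum_fact n : 0 < n ->
  factorization_sum q c n = \sum_(1 <= k < n.+1) q ^ (k - 1) * fact_sum k n.
Proof.
move=> n0; apply: eq_bigr => k _; rewrite -(@fact_sum_tuple n) ?n0 ?leqnn //.
by rewrite big_distrr.
Qed.

Lemma factorization_sum1 : factorization_sum q c 1 = 0.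
Proof. by rewrite factorization_sum_fact // big_nat1 fact_sum_big. Qed.

Lemma weightE n N : 0 < n < N -> weight n = \sum_(0 <= k < N) q ^ k * fact_sum k n.
Proof.
move=> /andP[n0 nN]; rewrite /weight big_ltn ?(leq_ltn_trans _ nN) //.
rewrite expn0 mul1n /=; congr addn.
rewrite factorization_sum_fact // big_distrr /= [RHS](@big_cat_nat _ _ _ n.+1) //=.
rewrite [X in _ = _ + X]big_nat [X in _ = _ + X]big1 ?addn0; last first.
  by move=> k /andP[lt _]; rewrite fact_sum_big ?muln0 // n0 ltnW.
rewrite !big_nat; apply: eq_bigr => k /andP[k0 _].
by rewrite mulnA -expnS subn1 prednK.
Qed.

Lemma factorization_sum_rec n : 1 < n ->
  factorization_sum q c n = \sum_(a <- divisors n | a < n) tails (n %/ a) * weight a.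
Proof.
move=> n1; have n0 := ltnW n1; rewrite factorization_sum_fact //.
rewrite big_add1 /= (eq_bigr (fun k => \sum_(a <- divisors n | a < n)
    tails (n %/ a) * (q ^ k * fact_sum k a))); last first.
  by move=> k _; rewrite subn1 big_distrr; apply: eq_bigr => a _; rewrite mulnCA.
rewrite exchange_big /= big_seq_cond [RHS]big_seq_cond.
apply: eq_bigr => a /andP[]; rewrite -dvdn_divisors // => dv lt.
by rewrite -big_distrr -weightE // (dvdn_gt0 n0 dv).
Qed.

End Nat.

(** The recursion says that the series of the [weight n], times [1 - q sigma],
    is 1. *)
Lemma dirichlet_weight (Q : rat) :
  is_dquot (dconst Q) (dsub (dconst 1) (dmul (dconst q%:R) (dsigma q c)))
    (fun n => Q * (weight n)%:R).
Proof.
move=> n n0; rewrite {1}/dmul (bigD1_seq n) ?divisors_uniq -?dvdn_divisors //=.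
rewrite divnn n0 {1}/dsub dmul_dconst // /dconst eqxx /dsigma /= mulr0 subr0 mulr1.
rewrite (eq_bigl (fun d => d != n)) // big_seq_cond.
rewrite (eq_bigr (fun d => - (Q * q%:R * (tails (n %/ d) * weight d)%:R))); last first.
  move=> d /andP[]; rewrite -dvdn_divisors // => dv dn.
  have d1 : (1 < n %/ d)%N.
    by move: (divnK dv) dn; case: (n %/ d)%N => [|[|k]] e dn //; lia.
  rewrite /dsub /dsigma dmul_dconst ?(ltnW d1) // d1.
  rewrite -/(tails (n %/ d)) /dconst (gtn_eqF d1) sub0r natrM; ring.
rewrite -big_seq_cond sumrN -mulr_sumr -natr_sum.
case: (n =P 1%N) => [n1|/eqP n1].
  rewrite n1 /weight factorization_sum1 (_ : divisors 1 = [:: 1%N]) //.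
  by rewrite big_cons big_nil eqxx /= muln0 mulr0 subr0 mulr1.
have n2 : (1 < n)%N by case: (n) n0 n1 => [|[|]].
rewrite {1}/weight (negPf n1) add0n factorization_sum_rec //.
rewrite [X in _ - _ * X%:R](_ : _ =
  \sum_(a <- divisors n | (a < n)%N) tails (n %/ a) * weight a)%N; last first.
  rewrite big_seq_cond [RHS]big_seq_cond; apply: eq_bigl => d.
  rewrite -dvdn_divisors //; case dv: (d %| n)%N => //=.
  by have := dvdn_leq n0 dv; rewrite ltn_neqAle => ->; rewrite andbT.
by rewrite natrM mulrA subrr.
Qed.

End Factorizations.

(** * The graded free algebra of rank two *)

Definition deg0 : word 'I_2 -> nat := wdeg_in ord0.
Definition deg1 : word 'I_2 -> nat := wdeg_in ord_max.

Lemma wdegE w : wdeg w = (deg0 w + deg1 w)%N.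
Proof.
rewrite /deg0 /deg1; elim: w => //= [v|w1 -> w2 ->]; last by rewrite addnACA.
by case: v => [[|[|]]].
Qed.

(** The degree of the value of [w] at elements of degrees [i] and [j]. *)
Definition wt (i j : nat) (w : word 'I_2) : nat := (i * deg0 w + j * deg1 w)%N.

Lemma wtM i j w1 w2 : wt i j (WMul w1 w2) = (wt i j w1 + wt i j w2)%N.
Proof. by rewrite /wt /deg0 /deg1 /=; lia. Qed.

Lemma wt11 w : wt 1 1 w = wdeg w.
Proof. by rewrite wdegE /wt !mul1n. Qed.

Section TwoGenerators.
Variables (u : bool) (K : fieldType) (E : set (napoly K nat)).
Variables (F : naAlgType u K) (x y : F).
Hypothesis hF : free_on E (pair_gen x y).
Hypothesis hgr : multigraded (pair_gen x y).
Hypothesis hF0 : exists a : F, a != 0.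

Local Notation G := (pair_gen x y).
Implicit Types (Q : nat -> nat -> bool) (a b f g : F).

(** ** Projections onto sums of multihomogeneous components *)

(** A relation splits into its multihomogeneous components, and hence into any sums
    of these; this makes the projections below well defined. *)
Lemma peval_bidegree0 (Q : nat -> nat -> bool) p : peval G p = 0 ->
  peval G [seq t <- p | Q (deg0 t.2) (deg1 t.2)] = 0.
Proof.
move=> p0; rewrite /peval.
rewrite (sum_by_key (fun t => (deg0 t.2, deg1 t.2))) big1_seq // => -[i j].
have /allP h : all (fun v : nat * nat => Q v.1 v.2) [seq (deg0 t.2, deg1 t.2) |
    t <- [seq t <- p | Q (deg0 t.2) (deg1 t.2)]] by rewrite all_map filter_all.
rewrite mem_undup => /h /= Qij {h}.
rewrite big_filter_cond.
rewrite -[RHS](hgr p0 (fun v => if v == ord0 then i else j)) /peval big_filter.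
apply: eq_bigl => s; rewrite xpair_eqE; apply/idP/forallP.
  move=> /andP[_ /andP[/eqP <- /eqP <-]] v.
  by case: v => [[|[|]] //= lt]; rewrite /deg0 /deg1; apply/eqP; congr wdeg_in;
     apply: val_inj.
move=> h; have := h ord0; have := h ord_max; rewrite /deg0 /deg1 /=.
by move=> /eqP -> /eqP ->; rewrite Qij !eqxx.
Qed.

Lemma F_gen a : exists2 p, all (fun t : K * word 'I_2 => predT t.2) p & a = peval G p.
Proof. exact: free_gen hF a. Qed.

Definition rep a : napoly K 'I_2 := s2val (cid2 (F_gen a)).
Lemma repP a : peval G (rep a) = a.
Proof. by rewrite /rep; case: cid2. Qed.

(** The sum of the components of [a] with bidegree in [Q]; the choice of [rep a] does
    not matter, by [proj_peval]. *)
Definition proj (Q : nat -> nat -> bool) (a : F) : F :=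
  peval G [seq t <- rep a | Q (deg0 t.2) (deg1 t.2)].

Lemma proj_peval Q p :
  proj Q (peval G p) = peval G [seq t <- p | Q (deg0 t.2) (deg1 t.2)].
Proof.
have := repP (peval G p); rewrite /proj; move: (rep _) => r e.
have /(peval_bidegree0 Q) : peval G (r ++ pscale (-1) p) = 0.
  by rewrite peval_cat peval_scale e scaleN1r subrr.
rewrite filter_cat peval_cat filter_map.
rewrite -[map _ _]/(pscale _ _) peval_scale scaleN1r => /eqP.
by rewrite subr_eq0 => /eqP.
Qed.

Fact proj_is_linear Q : linear (proj Q).
Proof.
move=> k a b; rewrite -[in LHS](repP a) -[in LHS](repP b).
rewrite -peval_scale -peval_cat proj_peval filter_cat peval_cat filter_map.
by rewrite -[map _ _]/(pscale _ _) peval_scale.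
Qed.
HB.instance Definition _ Q := GRing.isLinear.Build K F F _ (proj Q) (proj_is_linear Q).

Lemma proj_word Q w :
  proj Q (weval G w) = if Q (deg0 w) (deg1 w) then weval G w else 0.
Proof.
rewrite -[weval G w in LHS]peval_word proj_peval /=.
by case: ifP => _; rewrite ?peval_word // /peval big_nil.
Qed.

Lemma F_ind (Phi : F -> Prop) : Phi 0 ->
  (forall k a b, Phi a -> Phi b -> Phi (k *: a + b)) ->
  (forall w, Phi (weval G w)) -> forall a, Phi a.
Proof. by move=> h0 hl hw a; apply: (wspan_ind h0 hl) (F_gen a) => w _. Qed.

Lemma proj_eq Q Q' a : Q =2 Q' -> proj Q a = proj Q' a.
Proof. by move=> e; rewrite /proj; congr peval; apply: eq_filter => t; apply: e. Qed.

Lemma proj_proj Q Q' a : proj Q (proj Q' a) = proj (fun i j => Q i j && Q' i j) a.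
Proof.
move: a; apply: F_ind => [|k a b ha hb|w]; first by rewrite !linear0.
  by rewrite !linearP /= ha hb.
rewrite !proj_word; case: (Q' _ _); last by rewrite linear0 andbF.
by rewrite proj_word andbT.
Qed.

Lemma proj_none Q a : (forall i j, Q i j = false) -> proj Q a = 0.
Proof.
move=> QT; move: a; apply: F_ind => [|k a b ha hb|w]; first by rewrite !linear0.
  by rewrite !linearP /= ha hb scaler0 addr0.
by rewrite proj_word QT.
Qed.

Lemma proj_orb Q Q' a : (forall i j, ~~ (Q i j && Q' i j)) ->
  proj (fun i j => Q i j || Q' i j) a = proj Q a + proj Q' a.
Proof.
move=> dis; move: a; apply: F_ind => [|k a b ha hb|w]; first by rewrite !linear0 addr0.
  by rewrite !linearP /= ha hb scalerDr addrACA.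
rewrite !proj_word; move: (dis (deg0 w) (deg1 w)).
by case: (Q _ _); case: (Q' _ _) => //= _; rewrite ?addr0 ?add0r.
Qed.

Lemma proj_wspan Q a : wspan G (fun w => Q (deg0 w) (deg1 w)) (proj Q a).
Proof.
rewrite -[a]repP proj_peval; eexists => //.
exact: filter_all.
Qed.

Lemma wspan_proj Q a : wspan G (fun w => Q (deg0 w) (deg1 w)) a <-> proj Q a = a.
Proof.
split=> [[p hp ->]|<-]; last exact: proj_wspan.
by rewrite proj_peval; congr peval; apply/all_filterP.
Qed.

(** The weighted homogeneous components, where [x] has degree [i] and [y] has
    degree [j]. *)
Definition wcmp i j k : F -> F := proj (fun m n => i * m + j * n == k)%N.
HB.instance Definition _ i j k :=
  GRing.isLinear.Build K F F _ (wcmp i j k) (proj_is_linear _).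
Definition cmp : nat -> F -> F := wcmp 1 1.
HB.instance Definition _ k :=
  GRing.isLinear.Build K F F _ (cmp k) (proj_is_linear _).

Lemma wcmp_word i j k w :
  wcmp i j k (weval G w) = if wt i j w == k then weval G w else 0.
Proof. exact: proj_word. Qed.

Lemma cmp_word k w : cmp k (weval G w) = if wdeg w == k then weval G w else 0.
Proof. by rewrite /cmp wcmp_word wt11. Qed.

Lemma wcmp_wcmp i j k l a : wcmp i j k (wcmp i j l a) = if k == l then wcmp i j l a else 0.
Proof.
rewrite /wcmp proj_proj; case: eqP => [->|ne].
  by apply: proj_eq => m n; rewrite andbb.
by apply: proj_none => m n; apply/negP => /andP[/eqP e /eqP]; rewrite e.
Qed.

Lemma cmp_cmp k l a : cmp k (cmp l a) = if k == l then cmp l a else 0.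
Proof. exact: wcmp_wcmp. Qed.

Lemma wcmp_bound i j a : exists N, forall k, (N <= k)%N -> wcmp i j k a = 0.
Proof.
move: a; apply: F_ind => [|c a b [m hm] [n hn]|w].
- by exists 0%N => k _; rewrite linear0.
- exists (maxn m n) => k; rewrite geq_max => /andP[/hm e /hn e'].
  by rewrite linearP /= e e' scaler0 addr0.
- by exists (wt i j w).+1 => k; rewrite wcmp_word => lt; case: eqP => // e; lia.
Qed.

Lemma wcmp_sum i j N a : (forall k, (N <= k)%N -> wcmp i j k a = 0) ->
  a = \sum_(0 <= k < N) wcmp i j k a.
Proof.
have [M hM] : exists M, forall m, (M <= m)%N -> a = \sum_(0 <= k < m) wcmp i j k a.
  move: a; apply: F_ind => [|c a b [m hm] [n hn]|w].
  - by exists 0%N => m _; rewrite big1 // => k _; rewrite linear0.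
  - exists (maxn m n) => l; rewrite geq_max => /andP[/hm ea /hn eb].
    rewrite {1}ea {1}eb scaler_sumr -big_split; apply: eq_bigr => k _.
    by rewrite linearP.
  exists (wt i j w).+1 => m lt; rewrite (big_cat_nat (n := wt i j w) _ (ltnW lt)) //= (big_ltn lt).
  rewrite wcmp_word eqxx !big_nat !big1 ?add0r ?addr0 // => k /andP[k1 k2];
  by rewrite wcmp_word; case: eqP => // e; lia.
move=> h; rewrite {1}(hM (maxn M N)) ?leq_maxl // (big_cat_nat (n := N)) ?leq_maxr //=.
by rewrite [X in _ + X]big_nat [X in _ + X]big1 ?addr0 // => k /andP[/h].
Qed.

(** ** Degrees and products *)

Lemma x_word : weval G (WVar ord0) = x. Proof. by []. Qed.
Lemma y_word : weval G (WVar ord_max) = y. Proof. by []. Qed.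

Lemma cmp_one k : cmp k naone = if k == 0%N then naone else 0.
Proof. by rewrite -[naone]/(weval G WOne) cmp_word eq_sym. Qed.
Lemma cmp_x k : cmp k x = if k == 1%N then x else 0.
Proof. by rewrite -[in LHS]x_word cmp_word eq_sym. Qed.
Lemma cmp_y k : cmp k y = if k == 1%N then y else 0.
Proof. by rewrite -[in LHS]y_word cmp_word eq_sym. Qed.

Lemma cmpM n a b : cmp n (namul a b) = \sum_(i < n.+1) namul (cmp i a) (cmp (n - i) b).
Proof.
move: a; apply: F_ind => [|k a a' ha ha'|w].
- by rewrite namul0r linear0 big1 // => i _; rewrite linear0 namul0r.
- rewrite namulDl namulZl linearP /= ha ha' scaler_sumr -big_split.
  by apply: eq_bigr => i _; rewrite linearP /= namulDl namulZl.
move: b; apply: F_ind => [|k b b' hb hb'|w'].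
- by rewrite namulr0 linear0 big1 // => i _; rewrite linear0 namulr0.
- rewrite namulDr namulZr linearP /= hb hb' scaler_sumr -big_split.
  by apply: eq_bigr => i _; rewrite linearP /= namulDr namulZr.
rewrite -[namul _ _]/(weval G (WMul w w')) cmp_word /=.
case: eqP => [e|ne].
  have lt : (wdeg w < n.+1)%N by lia.
  rewrite (bigD1 (Ordinal lt)) //= !cmp_word eqxx.
  rewrite (_ : wdeg w' == _ = true); last by apply/eqP; lia.
  rewrite big1 ?addr0 // => i /negP ni; rewrite cmp_word; case: eqP => [ei|]; last first.
    by rewrite namul0r.
  by case: ni; apply/eqP; apply: val_inj; rewrite /= ei.
rewrite big1 // => i _; rewrite !cmp_word.
case: eqP => [e1|]; last by rewrite namul0r.
case: eqP => [e2|]; last by rewrite namulr0.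
by case: ne; have := ltn_ord i; lia.
Qed.

Definition deg_le n a := forall k, (n < k)%N -> cmp k a = 0.
Definition deg_ge n a := forall k, (k < n)%N -> cmp k a = 0.

Lemma deg_leM m n a b : deg_le m a -> deg_le n b ->
  deg_le (m + n) (namul a b) /\
  cmp (m + n) (namul a b) = namul (cmp m a) (cmp n b).
Proof.
move=> ha hb; split=> [k lt|].
  rewrite cmpM big1 // => i _; case: (ltnP m i) => [/ha ->|le]; first by rewrite namul0r.
  by rewrite (hb (k - i)%N) ?namulr0 //; have := ltn_ord i; lia.
have lt : (m < (m + n).+1)%N by lia.
rewrite cmpM (bigD1 (Ordinal lt)) //= addKn big1 ?addr0 // => i ne.
case: (ltngtP m i) => [/ha ->|lti|e]; first by rewrite namul0r.
  by rewrite (hb (m + n - i)%N) ?namulr0 //; lia.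
by case/eqP: ne; apply: val_inj.
Qed.

Lemma deg_geM m n a b : deg_ge m a -> deg_ge n b ->
  deg_ge (m + n) (namul a b) /\
  cmp (m + n) (namul a b) = namul (cmp m a) (cmp n b).
Proof.
move=> ha hb; split=> [k lt|].
  rewrite cmpM big1 // => i _; case: (ltnP i m) => [/ha ->|le]; first by rewrite namul0r.
  by rewrite (hb (k - i)%N) ?namulr0 //; have := ltn_ord i; lia.
have lt : (m < (m + n).+1)%N by lia.
rewrite cmpM (bigD1 (Ordinal lt)) //= addKn big1 ?addr0 // => i ne.
case: (ltngtP i m) => [/ha ->|lti|e]; first by rewrite namul0r.
  by rewrite (hb (m + n - i)%N) ?namulr0 //; have := ltn_ord i; lia.
by case/eqP: ne; apply: val_inj.
Qed.

Lemma deg_le_lin n k a b : deg_le n a -> deg_le n b -> deg_le n (k *: a + b).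
Proof. by move=> ha hb l lt; rewrite linearP /= ha // hb // scaler0 addr0. Qed.
Lemma deg_ge_lin n k a b : deg_ge n a -> deg_ge n b -> deg_ge n (k *: a + b).
Proof. by move=> ha hb l lt; rewrite linearP /= ha // hb // scaler0 addr0. Qed.
Lemma deg_le0 n : deg_le n 0. Proof. by move=> k _; rewrite linear0. Qed.
Lemma deg_ge0 n : deg_ge n 0. Proof. by move=> k _; rewrite linear0. Qed.
Lemma deg_le_leq m n a : (m <= n)%N -> deg_le m a -> deg_le n a.
Proof. by move=> le h k lt; apply: h; apply: leq_ltn_trans lt. Qed.
Lemma deg_ge_leq m n a : (n <= m)%N -> deg_ge m a -> deg_ge n a.
Proof. by move=> le h k lt; apply: h; apply: leq_trans le. Qed.

(** Parts of highest degree are multiplicative as long as they are allowed to vanish,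
    hence they commute with the evaluation of words. *)
Lemma top_word f g i j w : deg_le i f -> deg_le j g ->
  deg_le (wt i j w) (weval (pair_gen f g) w) /\
  cmp (wt i j w) (weval (pair_gen f g) w) = weval (pair_gen (cmp i f) (cmp j g)) w.
Proof.
move=> hf hg; elim: w => [|v|w1 [h1 e1] w2 [h2 e2]].
- rewrite /wt !muln0 /= cmp_one; split=> // k lt.
  by rewrite cmp_one; case: eqP => // e; rewrite e in lt.
- by case: v => [[|[|]]] //= lt; rewrite /wt /pair_gen /deg0 /deg1 /= ?muln0 ?muln1 ?addn0.
- by rewrite wtM; have [h e] := deg_leM h1 h2; split=> //=; rewrite e e1 e2.
Qed.

(** The analogue for parts of lowest degree. *)
Lemma low_word X (h : X -> F) w : (forall v, deg_ge 1 (h v)) ->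
  deg_ge (wdeg w) (weval h w) /\
  cmp (wdeg w) (weval h w) = weval (fun v => cmp 1 (h v)) w.
Proof.
move=> hh; elim: w => [|v|w1 [h1 e1] w2 [h2 e2]] //=.
- by rewrite cmp_one.
- by have [h' e] := deg_geM h1 h2; split=> //=; rewrite e e1 e2.
Qed.

Lemma low_wspan X (h : X -> F) n a : (forall v, deg_ge 1 (h v)) ->
  wspan h (fun w => n <= wdeg w)%N a -> deg_ge n a.
Proof.
move=> hh; move: a; apply: wspan_ind; first exact: deg_ge0.
  by move=> k a b; apply: deg_ge_lin.
by move=> w le; apply: deg_ge_leq le _; case: (low_word w hh).
Qed.

(** ** Endomorphisms *)

(** The endomorphism with [x] sent to [f] and [y] sent to [g]. *)
Definition ev f g : F -> F := sval (cid (hF.2 F (pair_gen f g) hF.1)).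

Lemma ev_spec f g : [/\ is_hom (ev f g), forall v, ev f g (G v) = pair_gen f g v
  & forall psi : F -> F, is_hom psi -> (forall v, psi (G v) = pair_gen f g v) ->
            psi =1 ev f g].
Proof. by rewrite /ev; case: cid. Qed.

Lemma ev_hom f g : is_hom (ev f g). Proof. by case: (ev_spec f g). Qed.
Fact ev_is_linear f g : linear (ev f g). Proof. by case: (ev_hom f g). Qed.
HB.instance Definition _ f g := GRing.isLinear.Build K F F _ (ev f g) (ev_is_linear f g).

Lemma ev_x f g : ev f g x = f.
Proof. by have [_ h _] := ev_spec f g; apply: (h ord0). Qed.
Lemma ev_y f g : ev f g y = g.
Proof. by have [_ h _] := ev_spec f g; apply: (h ord_max). Qed.
Lemma ev_one f g : ev f g naone = naone.
Proof. by case: (ev_hom f g). Qed.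
Lemma ev_word f g w : ev f g (weval G w) = weval (pair_gen f g) w.
Proof.
rewrite (hom_weval (ev_hom f g)); congr weval; apply: funext => v /=.
by case: (ev_spec f g).
Qed.
Lemma ev_uniq f g (psi : F -> F) :
  is_hom psi -> psi x = f -> psi y = g -> psi =1 ev f g.
Proof.
move=> hpsi hx hy; have [_ _ h] := ev_spec f g; apply: h => // v.
by rewrite /pair_gen; case: ifP.
Qed.
Lemma ev_comp f g f' g' a : ev f g (ev f' g' a) = ev (ev f g f') (ev f g g') a.
Proof.
apply: (ev_uniq (psi := ev f g \o ev f' g')); rewrite /= ?ev_x ?ev_y //.
exact: hom_comp (ev_hom _ _) (ev_hom _ _).
Qed.
Lemma ev_xy a : ev x y a = a.
Proof. by apply/esym; apply: (ev_uniq (psi := id)) => //; apply: hom_id. Qed.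

Lemma ev_wspan f g P a : wspan G P a -> wspan (pair_gen f g) P (ev f g a).
Proof.
move: a; apply: wspan_ind; first by rewrite linear0; apply: wspan0.
  by move=> k a b ha hb; rewrite linearP; apply: wspanD hb; apply: wspanZ.
by move=> w Pw; rewrite ev_word; apply: wspan_word.
Qed.

(** Only the words of maximal weight in [a] contribute to the part of highest degree,
    where [x] and [y] have the degrees of [f] and [g] as weights. *)
Lemma top_ev f g i j n a : deg_le i f -> deg_le j g ->
  (forall k, (n < k)%N -> wcmp i j k a = 0) ->
  deg_le n (ev f g a) /\
  cmp n (ev f g a) = ev (cmp i f) (cmp j g) (wcmp i j n a).
Proof.
move=> hf hg ha.
have : wspan G (fun w => wt i j w <= n)%N a.
  rewrite [a](@wcmp_sum i j n.+1) //.
  apply: big_ind => [||k _]; [exact: wspan0|exact: wspanD|].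
  case: (leqP k n) => [le|/ha ->]; last exact: wspan0.
  by apply: wspanS (proj_wspan _ _) => w /eqP; rewrite /wt => ->.
move: (a) {ha}; apply: wspan_ind => [|c b b' [h1 e1] [h2 e2]|w le].
- by rewrite !linear0; split=> //; apply: deg_le0.
- split; first by rewrite linearP; apply: deg_le_lin.
  by rewrite !linearP /= e1 e2.
rewrite ev_word wcmp_word; have [h e] := top_word w hf hg.
split; first exact: deg_le_leq h.
case: eqP => [<-|ne]; first by rewrite e ev_word.
by rewrite linear0 h //; lia.
Qed.

Lemma low_ev f g n a : deg_ge 1 f -> deg_ge 1 g -> deg_ge n a ->
  deg_ge n (ev f g a) /\ cmp n (ev f g a) = ev (cmp 1 f) (cmp 1 g) (cmp n a).
Proof.
move=> hf hg ha.
have hfg v : deg_ge 1 (pair_gen f g v) by rewrite /pair_gen; case: ifP.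
have hcmp : (fun v => cmp 1 (pair_gen f g v)) = pair_gen (cmp 1 f) (cmp 1 g).
  by apply: funext => v; rewrite /pair_gen; case: ifP.
have : wspan G (fun w => n <= wdeg w)%N a.
  have [N hN] := wcmp_bound 1 1 a.
  rewrite [a](@wcmp_sum 1 1 N) //.
  apply: big_ind => [||k _]; [exact: wspan0|exact: wspanD|].
  case: (leqP n k) => [le|/ha h]; last by rewrite -/(cmp k a) h; apply: wspan0.
  by apply: wspanS (proj_wspan _ _) => w; rewrite -/(wt 1 1 w) wt11 => /eqP ->.
move: (a) {ha}; apply: wspan_ind => [|c b b' [h1 e1] [h2 e2]|w le].
- by rewrite !linear0; split=> //; apply: deg_ge0.
- split; first by rewrite linearP; apply: deg_ge_lin.
  by rewrite !linearP /= e1 e2.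
rewrite ev_word cmp_word; have [h e] := low_word w hfg.
split; first exact: deg_ge_leq h.
case: eqP => [<-|ne]; first by rewrite e ev_word hcmp.
by rewrite linear0 h //; lia.
Qed.

(** ** Linear parts *)

(** If [x] vanished, so would each element of [F], being an image of [x]. *)
Lemma x_neq0 : x != 0.
Proof.
apply/negP => /eqP x0; have [a] := hF0; apply/negP/negPn/eqP.
by rewrite -(ev_x a 0) {1}x0 linear0.
Qed.

Lemma y_neq0 : y != 0.
Proof.
apply/negP => /eqP y0; have [a] := hF0; apply/negP/negPn/eqP.
by rewrite -(ev_y 0 a) {1}y0 linear0.
Qed.

Lemma proj_x Q : proj Q x = if Q 1%N 0%N then x else 0.
Proof. by rewrite -[in LHS]x_word proj_word. Qed.
Lemma proj_y Q : proj Q y = if Q 0%N 1%N then y else 0.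
Proof. by rewrite -[in LHS]y_word proj_word. Qed.
Lemma proj_one Q : proj Q naone = if Q 0%N 0%N then naone else 0.
Proof. by rewrite -[in LHS](_ : weval G WOne = naone) // proj_word. Qed.

Lemma xy_indep k l m : k *: x + l *: y = m *: naone -> k = 0 /\ l = 0.
Proof.
move=> e.
have /eqP := congr1 (proj (fun i j => (i == 1) && (j == 0))%N) e.
rewrite linearP !linearZ /= proj_x proj_y proj_one /= !scaler0 addr0 scaler_eq0.
rewrite (negPf x_neq0) orbF => /eqP ->.
have /eqP := congr1 (proj (fun i j => (i == 0) && (j == 1))%N) e.
rewrite linearP !linearZ /= proj_x proj_y proj_one /= !scaler0 add0r scaler_eq0.
by rewrite (negPf y_neq0) orbF => /eqP ->.
Qed.

Lemma cmp0_const a : exists k, cmp 0 a = k *: naone.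
Proof.
apply: (wspan_deg0 _ (proj_wspan _ _)) => w; rewrite -/(wt 1 1 w) wt11.
by move/eqP.
Qed.

Lemma cmp1_lin a : exists k l, cmp 1 a = k *: x + l *: y.
Proof.
have [|l e] := wspan_deg1 (g := G) _ (proj_wspan (fun i j => 1 * i + 1 * j == 1)%N a).
  by move=> w; rewrite -/(wt 1 1 w) wt11 => /eqP.
rewrite /cmp /wcmp e; elim: l {e} => [|[c v] l [k [m ih]]].
  by exists 0, 0; rewrite big_nil !scale0r addr0.
rewrite big_cons ih /= /pair_gen; case: ifP => _.
  by exists (c + k), m; rewrite scalerDl addrA.
by exists k, (c + m); rewrite scalerDl addrCA.
Qed.

Lemma ev_lin_bij k l m n : k * n - l * m != 0 ->
  bijective (ev (k *: x + l *: y) (m *: x + n *: y)).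
Proof.
set d := k * n - l * m => d0.
pose f' := (n / d) *: x + (- l / d) *: y; pose g' := (- m / d) *: x + (k / d) *: y.
exists (ev f' g') => a; rewrite ev_comp -[RHS]ev_xy !(linearD, linearZ) /= !(ev_x, ev_y).
  congr ev; rewrite /f' /g' !scalerDr !scalerA addrACA -!scalerDl.
    have -> : k * (n / d) + l * (- m / d) = 1 by rewrite /d; field.
    have -> : k * (- l / d) + l * (k / d) = 0 by rewrite /d; field.
    by rewrite scale1r scale0r addr0.
  have -> : m * (n / d) + n * (- m / d) = 0 by rewrite /d; field.
  have -> : m * (- l / d) + n * (k / d) = 1 by rewrite /d; field.
  by rewrite scale1r scale0r add0r.
congr ev; rewrite !scalerDr !scalerA addrACA -!scalerDl.
  have -> : n / d * k + - l / d * m = 1 by rewrite /d; field.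
  have -> : n / d * l + - l / d * n = 0 by rewrite /d; field.
  by rewrite scale1r scale0r addr0.
have -> : - m / d * k + k / d * m = 0 by rewrite /d; field.
have -> : - m / d * l + k / d * n = 1 by rewrite /d; field.
by rewrite scale1r scale0r add0r.
Qed.

Lemma least_component a : a != 0 -> exists n, deg_ge n a /\ cmp n a != 0.
Proof.
move=> a0; have [n hn] : exists n, cmp n a != 0.
  apply: contrapT => h; case/negP: a0; have [N hN] := wcmp_bound 1 1 a.
  rewrite [a](@wcmp_sum 1 1 N) // big1 // => k _; apply/eqP/negPn/negP => hk.
  by apply: h; exists k.
have hex : exists n, cmp n a != 0 by exists n.
case: (ex_minnP hex) => m hm min; exists m; split=> // k lt.
by apply/eqP/negPn/negP => /min; rewrite leqNgt lt.
Qed.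

Lemma greatest_component i j a : a != 0 ->
  exists n, (forall k, (n < k)%N -> wcmp i j k a = 0) /\ wcmp i j n a != 0.
Proof.
move=> a0; have [N hN] := wcmp_bound i j a.
have hex : exists n, wcmp i j n a != 0.
  apply: contrapT => h; case/negP: a0.
  rewrite [a](@wcmp_sum i j N) // big1 // => k _; apply/eqP/negPn/negP => hk.
  by apply: h; exists k.
have ub n : wcmp i j n a != 0 -> (n <= N)%N.
  by rewrite leqNgt; apply: contra => lt; rewrite hN // ltnW.
case: (ex_maxnP hex ub) => m hm max; exists m; split=> // k lt.
by apply/eqP/negPn/negP => /max; rewrite leqNgt lt.
Qed.

(** An endomorphism without constant terms is injective as soon as its linear part
    is invertible: it acts on the component of lowest degree by its linear part. *)
Lemma ev_inj_of_linear_part f g k l m n : deg_ge 1 f -> deg_ge 1 g ->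
  cmp 1 f = k *: x + l *: y -> cmp 1 g = m *: x + n *: y ->
  k * n - l * m != 0 -> forall a, ev f g a = 0 -> a = 0.
Proof.
move=> hf hg ef eg d0 a ea; apply/eqP; apply: contraT => a0.
have [d [da]] := least_component a0; case/eqP.
have [_] := low_ev hf hg da; rewrite ea linear0 ef eg => /esym e.
by apply: (bij_inj (ev_lin_bij d0)); rewrite e linear0.
Qed.

(** ** Subalgebras generated by two elements *)

(** A combination of words in elements without constant terms has as constant term
    the contribution of the words of degree 0. *)
Lemma wspan_no_const (A : naAlgType u K) X (psi : A -> F) (g : X -> A) (a : A) :
  is_hom psi -> injective psi -> (forall v, deg_ge 1 (psi (g v))) ->
  cmp 0 (psi a) = 0 -> wspan g predT a -> wspan g (fun w => 1 <= wdeg w)%N a.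
Proof.
move=> hpsi inj hg a0 /(wspan_split (fun w => wdeg w == 0%N)) [a' [a1 [h0 h1 ea]]].
have h1' : wspan g (fun w => 1 <= wdeg w)%N a1.
  by apply: wspanS h1 => w; rewrite lt0n.
have [k ek] : exists k, a' = k *: naone by apply: wspan_deg0 h0 => w /eqP.
suff -> : a = a1 by [].
rewrite ea (_ : a' = 0) ?add0r //; apply: inj; rewrite (hom_0 hpsi).
move: a0; rewrite ea (hom_D hpsi) linearD /=.
have -> : cmp 0 (psi a1) = 0 by apply: (low_wspan hg (wspan_hom hpsi h1')).
by rewrite addr0 ek (hom_Z hpsi) (hom_one hpsi) linearZ /= cmp_one eqxx.
Qed.

Hypothesis hNS : nielsen_schreier u E.

(** The subalgebra [S] generated by [f] and [g] is free, and its free generators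
    [B v] can be taken without constant terms.  If some 2 x 2 minor of the matrix of
    the linear parts of [f] and [g] in the [B v] is nonzero, then the homomorphism
    from [S] to [F] that maps the two corresponding generators to [x] and [y] and the
    others to 0 sends [f] and [g] to elements with an invertible linear part, which
    satisfy no relation; hence neither do [f] and [g].  If all minors vanish, then
    some nontrivial combination of [f] and [g] has linear part 0, that is, lies in the
    span of the words of degree at least 2 in the [B v].  As the [B v] are polynomials
    in [f] and [g] without constant terms, the same holds for words in [f] and [g]. *)
Lemma free_or_linear_dependence f g : deg_ge 1 f -> deg_ge 1 g ->
  (forall a, ev f g a = 0 -> a = 0) \/
  exists k l, (k != 0) || (l != 0) /\
    wspan (pair_gen f g) (fun w => 2 <= wdeg w)%N (k *: f + l *: g).
Proof.
move=> hf hg; pose im a := exists c, a = ev f g c.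
have im0 : im 0 by exists 0; rewrite linear0.
have iml k a b : im a -> im b -> im (k *: a + b).
  by move=> [c ->] [d ->]; exists (k *: c + d); rewrite linearP.
have imM a b : im a -> im b -> im (namul a b).
  by move=> [c ->] [d ->]; exists (namul c d); rewrite (hom_mul (ev_hom f g)).
have im1 : im naone by exists naone; rewrite ev_one.
pose S := subalg_of im0 iml imM im1.
have fP : f \in S by apply/(subalg_ofP im0 iml imM im1); exists x; rewrite ev_x.
have gP : g \in S by apply/(subalg_ofP im0 iml imM im1); exists y; rewrite ev_y.
pose fS : subalg_type S := SubalgElt fP; pose gS : subalg_type S := SubalgElt gP.
have hval := val_hom S; have inj_val : injective (val : subalg_type S -> F) := val_inj.
have [Y0 [b0 hb0]] := hNS hF S.
pose Y : eqType := {classic Y0}; pose b : Y -> subalg_type S := b0.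
have hb : free_on E b by [].
(* The generators are shifted by their constant terms [e v]. *)
have [e he] := choice (fun v => cmp0_const (val (b v))).
pose B v : subalg_type S := (- e v) *: naone + b v.
have B0 v : cmp 0 (val (B v)) = 0.
  by rewrite (hom_lin hval) (hom_one hval) linearP /= he cmp_one scaleNr addNr.
have B1 v : deg_ge 1 (val (B v)) by move=> k; rewrite ltnS leqn0 => /eqP ->.
have genB s : wspan B predT s.
  move: s (free_gen hb s); apply: wspan_ind; first exact: wspan0.
    by move=> k a c ha hc; apply: wspanD hc; apply: wspanZ.
  elim=> [_|v _|w1 h1 w2 h2 _].
  - exact: (@wspan_word _ _ _ _ B predT WOne).
  - have -> : weval b (WVar v) = e v *: naone + B v.
      by rewrite /B addrA -scalerDl subrr scale0r add0r.
    apply: wspanD; first by apply/wspanZ/(@wspan_word _ _ _ _ B predT WOne).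
    exact: (@wspan_word _ _ _ _ B predT (WVar v)).
  - exact: wspanM (h1 isT) (h2 isT).
have lin_part s : deg_ge 1 (val s) ->
    exists (l : seq (K * Y)) r, s = \sum_(t <- l) t.1 *: B t.2 + r /\
      wspan B (fun w => 2 <= wdeg w)%N r.
  move=> hs; have := wspan_no_const hval inj_val B1 (hs 0%N isT) (genB s).
  move=> /(wspan_split (fun w => wdeg w == 1%N)) [s1 [r [h1 hr ->]]].
  have [l ->] := wspan_deg1 (fun w hw => eqP (proj2 (andP hw))) h1.
  exists l, r; split=> //; apply: wspanS hr => w; lia.
have [lf [rf [ef hrf]]] := lin_part fS hf.
have [lg [rg [eg hrg]]] := lin_part gS hg.
pose L (l : seq (K * Y)) v := \sum_(t <- l | t.2 == v) t.1.
have [[v1 [v2 d0]]|dep] :=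
    pselect (exists v1 v2, L lf v1 * L lg v2 - L lf v2 * L lg v1 != 0).
  left; have ne12 : v2 == v1 = false.
    by apply/negP => /eqP e12; rewrite e12 subrr eqxx in d0.
  pose h v := if v == v1 then x else if v == v2 then y else 0.
  have h1 v : deg_ge 1 (h v).
    rewrite /h; case: ifP => _; last case: ifP => _; try exact: deg_ge0.
      by move=> k k0; rewrite cmp_x; case: eqP => // ek; rewrite ek in k0.
    by move=> k k0; rewrite cmp_y; case: eqP => // ek; rewrite ek in k0.
  have [rho [hrho rhob _]] := hb.2 F (fun v => e v *: naone + h v) hF.1.
  have rhoB v : rho (B v) = h v.
    rewrite /B (hom_lin hrho) rhob (hom_one hrho) addrA -scalerDl addNr.
    by rewrite scale0r add0r.
  have rhoBh : rho \o B = h by apply: funext => v /=; rewrite rhoB.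
  have rho_lin l r : wspan B (fun w => 2 <= wdeg w)%N r ->
      deg_ge 1 (rho (\sum_(t <- l) t.1 *: B t.2 + r)) /\
      cmp 1 (rho (\sum_(t <- l) t.1 *: B t.2 + r)) = L l v1 *: x + L l v2 *: y.
    move=> hr; have r2 : deg_ge 2 (rho r).
      by apply: (low_wspan h1); rewrite -rhoBh; apply: wspan_hom.
    have -> : rho (\sum_(t <- l) t.1 *: B t.2 + r) = L l v1 *: x + L l v2 *: y + rho r.
      rewrite (hom_D hrho); congr (_ + _); rewrite /L.
      elim: l => [|t l ih]; first by rewrite !big_nil (hom_0 hrho) !scale0r addr0.
      rewrite !big_cons (hom_lin hrho) ih rhoB /h; case: eqP => [->|_].
        by rewrite eq_sym ne12 scalerDl addrA.
      by case: eqP => _; [rewrite scalerDl addrCA|rewrite scaler0 add0r].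
    split=> [k|]; last first.
      rewrite !(linearD, linearZ) /= cmp_x cmp_y !eqxx r2 // addr0 //.
    rewrite ltnS leqn0 => /eqP ->.
    by rewrite !(linearD, linearZ) /= cmp_x cmp_y r2 // !scaler0 !addr0.
  have [f1 cf] := rho_lin lf rf hrf; have [g1 cg] := rho_lin lg rg hrg.
  rewrite -ef in f1 cf; rewrite -eg in g1 cg.
  move=> a ea; apply: (ev_inj_of_linear_part f1 g1 cf cg d0).
  have [p _ ep] := F_gen a; rewrite ep (hom_peval (ev_hom _ _)).
  have evG f' g' : ev f' g' \o G = pair_gen f' g'.
    by apply: funext => v; have [_ hG _] := ev_spec f' g'; apply: hG.
  move: ea; rewrite ep (hom_peval (ev_hom _ _)) !evG => ea.
  have -> : pair_gen (rho fS) (rho gS) = rho \o pair_gen fS gS.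
    by apply: funext => v; rewrite /pair_gen /=; case: ifP.
  rewrite -(hom_peval hrho) (_ : peval _ _ = 0) ?(hom_0 hrho) //.
  apply: inj_val; rewrite (hom_0 hval) (hom_peval hval) -ea; congr peval.
  by apply: funext => v; rewrite /pair_gen /=; case: ifP.
right; have det0 v1 v2 : L lf v1 * L lg v2 = L lf v2 * L lg v1.
  apply/eqP; rewrite -subr_eq0; apply/negPn/negP => ne.
  by apply: dep; exists v1, v2.
(* The two rows of the matrix of linear parts are proportional. *)
have [k [l [kl0 hkl]]] : exists k l, (k != 0) || (l != 0) /\
    forall v, k * L lf v + l * L lg v = 0.
  have [[v1 hv1]|h0] := pselect (exists v1, L lf v1 != 0).
    exists (- L lg v1), (L lf v1); split; first by rewrite hv1 orbT.
    by move=> v; rewrite mulNr (det0 v1) addrC mulrC subrr.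
  exists 1, 0; split=> [|v]; first by rewrite oner_eq0.
  rewrite mul1r mul0r addr0; apply/eqP/negPn/negP => ne.
  by apply: h0; exists v.
exists k, l; split=> //.
have e2 : k *: fS + l *: gS = k *: rf + l *: rg.
  rewrite ef eg !scalerDr addrACA -[RHS]add0r; congr (_ + _).
  pose l' := [seq (k * t.1, t.2) | t <- lf] ++ [seq (l * t.1, t.2) | t <- lg].
  rewrite -[RHS](@collect0 _ _ _ _ B l').
    rewrite /l' big_cat !big_map !scaler_sumr /=.
    by congr (_ + _); apply: eq_bigr => t _; rewrite scalerA.
  by move=> v; rewrite /l' big_cat !big_map /= -!mulr_sumr; apply: hkl.
have -> : k *: f + l *: g = val (k *: fS + l *: gS).
  by rewrite (hom_lin hval) (hom_Z hval).
rewrite e2; apply: (@wspan_ge_subst _ _ _ _ _ _ (val \o B)); last first.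
  apply: wspan_hom hval _; apply: wspanD; exact: wspanZ.
move=> v; have hfg i : deg_ge 1 (pair_gen f g i) by rewrite /pair_gen; case: ifP.
apply: (wspan_no_const (hom_id F) (@inj_id F) hfg (B0 v)).
have [c ec] := elimT (subalg_ofP im0 iml imM im1 _) (valP (B v)).
have h : wspan (pair_gen f g) predT (ev f g c) by apply: ev_wspan; exact: F_gen.
by rewrite -ec in h; exact: h.
Qed.

(** ** Polynomials in one variable *)

(** The polynomials in [x] alone with degrees in [Q], as the fixed points of a linear
    projection. *)
Definition pure (Q : pred nat) h := proj (fun i j => Q i && (j == 0%N)) h = h.

Lemma pure_wspan (Q : pred nat) h :
  pure Q h <-> wspan G (fun w => Q (deg0 w) && (deg1 w == 0%N)) h.
Proof. by split=> [<-|hw]; [exact: proj_wspan|exact/wspan_proj]. Qed.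

Lemma pure_lin (Q : pred nat) k a b : pure Q a -> pure Q b -> pure Q (k *: a + b).
Proof. by rewrite /pure linearP /= => -> ->. Qed.
Lemma pure0 (Q : pred nat) : pure Q 0.
Proof. exact: linear0. Qed.
Lemma pureZ (Q : pred nat) k a : pure Q a -> pure Q (k *: a).
Proof. by rewrite /pure linearZ /= => ->. Qed.
Lemma pureD (Q : pred nat) a b : pure Q a -> pure Q b -> pure Q (a + b).
Proof. by rewrite /pure linearD /= => -> ->. Qed.
Lemma pureS (P Q : pred nat) h : (forall i, P i -> Q i) -> pure P h -> pure Q h.
Proof.
by move=> PQ /pure_wspan hh; apply/pure_wspan; apply: wspanS hh => w /andP[/PQ -> ->].
Qed.
Lemma pure_x (Q : pred nat) : Q 1%N -> pure Q x.
Proof. by move=> Q1; rewrite /pure proj_x Q1. Qed.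

Lemma pure_ev (Q : pred nat) f g g' h : pure Q h -> ev f g h = ev f g' h.
Proof.
move=> /pure_wspan; move: h; apply: wspan_ind => [|k a b ha hb|w /andP[_ /eqP]].
- by rewrite !linear0.
- by rewrite !linearP /= ha hb.
rewrite !ev_word; elim: w => //= [v|w1 h1 w2 h2]; last first.
  rewrite /deg1 /= => /eqP; rewrite addn_eq0 => /andP[/eqP e1 /eqP e2].
  by rewrite h1 // h2.
by case: v => [[|[|]]].
Qed.

Lemma pure_evx (Q : pred nat) g h : pure Q h -> ev x g h = h.
Proof. by move=> hh; rewrite (pure_ev x g y hh) ev_xy. Qed.

(** Words in a single letter are the words in two letters that avoid the second. *)
Lemma homog_pure n h : homog (fun _ : unit => x) n h <-> pure (pred1 n) h.
Proof.
rewrite pure_wspan -[homog _ n]/(wspan (fun _ : unit => x) (fun w => wdeg w == n)); split.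
  move: h; apply: wspan_ind => [|k a b ha hb|w]; first exact: wspan0.
    by apply: wspanD hb; apply: wspanZ.
  pose fix incl (w : word unit) : word 'I_2 := match w with
    WOne => WOne | WVar _ => WVar ord0 | WMul w1 w2 => WMul (incl w1) (incl w2) end.
  move=> /eqP ew; have [e [d1 ->]] :
      deg0 (incl w) = wdeg w /\ deg1 (incl w) = 0%N /\
      weval (fun _ => x) w = weval G (incl w).
    elim: w {ew} => //= w1 [e1 [d1 ->]] w2 [e2 [d2 ->]].
    by move: e1 e2 d1 d2; rewrite /deg0 /deg1 /= => -> -> -> ->.
  by apply: wspan_word; rewrite /= e d1 ew !eqxx.
move: h; apply: wspan_ind => [|k a b ha hb|w]; first exact: wspan0.
  by apply: wspanD hb; apply: wspanZ.
pose fix collapse (w : word 'I_2) : word unit := match w with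
  WOne => WOne | WVar _ => WVar tt | WMul w1 w2 => WMul (collapse w1) (collapse w2) end.
move=> /andP[/eqP <- /eqP d1].
have [e ->] : wdeg (collapse w) = deg0 w /\
    weval G w = weval (fun _ => x) (collapse w).
  elim: w d1 => //= [[[|[|]]]|w1 h1 w2 h2] //.
  rewrite {1}/deg1 /= => /eqP; rewrite addn_eq0 => /andP[/eqP e1 /eqP e2].
  by have [d1 ->] := h1 e1; have [d2 ->] := h2 e2; rewrite /deg0 /= d1 d2.
by apply: wspan_word; rewrite /= e.
Qed.

Lemma pure_linear h : pure (pred1 1%N) h -> exists k, h = k *: x.
Proof.
move=> /pure_wspan; move: h; apply: wspan_ind => [|k a b [k1 ->] [k2 ->]|w].
- by exists 0; rewrite scale0r.
- by exists (k * k1 + k2); rewrite scalerDl scalerA.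
move=> /andP[/eqP w0 /eqP w1].
have [k [v ev1]] : exists k v, weval G w = k *: G v.
  by apply: weval_deg1; rewrite wdegE w0 w1.
case: v ev1 => [[|[|]]] //= lt; rewrite /pair_gen /= => ev1; first by exists k.
have := proj_word (fun i j => (i == 1) && (j == 0))%N w.
rewrite w0 w1 /= ev1 linearZ /= proj_y /= scaler0 => <-.
by exists 0; rewrite scale0r.
Qed.

(** ** Leading terms *)

Definition has_top (a : nat) f := deg_le a f /\ cmp a f != 0.

Lemma homog_deg_le (a : nat) f : cmp a f = f -> deg_le a f.
Proof. by move=> <- k lt; rewrite cmp_cmp; case: eqP => // e; rewrite e ltnn in lt. Qed.

Lemma homog_deg_ge (a : nat) f : cmp a f = f -> deg_ge a f.
Proof. by move=> <- k lt; rewrite cmp_cmp; case: eqP => // e; rewrite e ltnn in lt. Qed.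

Lemma cmp_ev_homog f g (a b : nat) n c : cmp a f = f -> cmp b g = g ->
  cmp n (ev f g c) = ev f g (wcmp a b n c).
Proof.
move=> hf hg; move: c; apply: F_ind => [|k c d hc hd|w]; first by rewrite !linear0.
  by rewrite !linearP /= hc hd.
have [_ ] := top_word w (homog_deg_le hf) (homog_deg_le hg).
rewrite hf hg => e; rewrite wcmp_word ev_word -e cmp_cmp eq_sym e.
by case: ifP => _; rewrite ?ev_word ?linear0.
Qed.

(** A word of degree at least 2 in elements of degrees [a <= b] has degree greater
    than [a], and if its degree is [b] then it avoids the second letter.  Thus the
    component of degree [a] of the relation shows that [l] is nonzero, and the one of
    degree [b] expresses [g] through [f]. *)
Lemma homog_dependent f g (a b : nat) k l : (0 < a)%N -> (a <= b)%N ->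
  cmp a f = f -> f != 0 -> cmp b g = g -> g != 0 -> (k != 0) || (l != 0) ->
  wspan (pair_gen f g) (fun w => 2 <= wdeg w)%N (k *: f + l *: g) ->
  exists m h, [/\ b = (m * a)%N, pure (pred1 m) h & g = ev f 0 h].
Proof.
move=> a0 ab hf f0 hg g0 kl [p hp ep].
have [c hc ec] : exists2 c, proj (fun i j => 2 <= i + j)%N c = c &
    k *: f + l *: g = ev f g c.
  exists (peval G p).
    apply/(wspan_proj (fun i j => 2 <= i + j)%N); exists p => //.
    by apply: sub_all hp => t; rewrite wdegE.
  rewrite (hom_peval (ev_hom f g)) ep; congr peval; apply: funext => v /=.
  by case: (ev_spec f g).
have comp n : k *: cmp n f + l *: cmp n g =
    ev f g (proj (fun i j => (a * i + b * j == n) && (2 <= i + j))%N c).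
  by rewrite -proj_proj hc -(cmp_ev_homog n c hf hg) -ec linearP linearZ.
have l0 : l != 0.
  apply/negP => /eqP l0; move: kl (comp a); rewrite l0 eqxx orbF scale0r addr0 hf => k0.
  rewrite proj_none => [|i j]; last by apply/negP => /andP[/eqP e le]; nia.
  by rewrite linear0 => /eqP; rewrite scaler_eq0 (negPf k0) (negPf f0).
have := comp b; rewrite hg; case: (ltngtP a b) ab => // [lt|<-] _; last first.
  rewrite hf proj_none => [|i j]; last by apply/negP => /andP[/eqP e le]; nia.
  rewrite linear0 => /eqP; rewrite addrC addr_eq0 => /eqP e.
  exists 1%N, (- (k / l) *: x); split; first by rewrite mul1n.
    by apply: pureZ; apply: pure_x.
  rewrite linearZ /= ev_x scaleNr mulrC -scalerA -scalerN -e scalerA mulVf //.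
  by rewrite scale1r.
rewrite (homog_deg_le hf) // scaler0 add0r => e.
have [dv|ndv] := boolP (a %| b)%N; last first.
  move: e; rewrite proj_none => [|i j]; last first.
    apply/negP => /andP[/eqP e le]; case: j e le => [|j] e le; last by nia.
    by move: ndv; rewrite -e muln0 addn0 dvdn_mulr.
  by rewrite linear0 => /eqP; rewrite scaler_eq0 (negPf l0) (negPf g0).
have eb := divnK dv; set m := (b %/ a)%N in eb.
have hpure : pure (pred1 m) (proj (fun i j => (a * i + b * j == b) && (2 <= i + j))%N c).
  rewrite /pure proj_proj; apply: proj_eq => i j.
  apply/idP/idP => [/andP[]//|/andP[/eqP e1 e2]]; rewrite e1 eqxx e2 !andbT /=.
  by case: j e1 e2 => [|j] e1 e2; [rewrite andbT; apply/eqP|]; nia.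
exists m, (l^-1 *: proj (fun i j => (a * i + b * j == b) && (2 <= i + j))%N c).
split=> //; first exact: pureZ.
by rewrite linearZ /= (pure_ev f 0 g hpure) -e scalerA mulVf // scale1r.
Qed.

Lemma independent_or_poly f g (a b : nat) : (0 < a)%N -> (a <= b)%N ->
  cmp a f = f -> f != 0 -> cmp b g = g -> g != 0 ->
  (forall c, ev f g c = 0 -> c = 0) \/
  exists m h, [/\ b = (m * a)%N, pure (pred1 m) h & g = ev f 0 h].
Proof.
move=> a0 ab hf f0 hg g0.
have f1 : deg_ge 1 f := deg_ge_leq a0 (homog_deg_ge hf).
have g1 : deg_ge 1 g := deg_ge_leq (leq_trans a0 ab) (homog_deg_ge hg).
case: (free_or_linear_dependence f1 g1) => [|[k [l [kl hw]]]]; first by left.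
by right; apply: homog_dependent a0 ab hf f0 hg g0 kl hw.
Qed.

(** A homogeneous element [f] of positive degree is not a polynomial both in [x] and
    in [y], so that it is independent of one of them; hence it is not a root of a
    nonzero polynomial. *)
Lemma homog_transcendental f (a : nat) (Q : pred nat) h : (0 < a)%N -> cmp a f = f -> f != 0 ->
  pure Q h -> ev f 0 h = 0 -> h = 0.
Proof.
move=> a0 hf f0 hh e.
(* The polynomial [h(y)] is a relation between [z] and [f] for each [z]. *)
have key z : ev z f (ev y 0 h) = 0.
  by rewrite ev_comp ev_y linear0.
have back : ev y 0 h = 0 -> h = 0.
  move=> e'; have := ev_comp 0 x y 0 h; rewrite e' linear0 ev_y.
  by rewrite (pure_evx _ hh).
have cx : cmp 1 x = x by rewrite cmp_x.
have cy : cmp 1 y = y by rewrite cmp_y.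
case: (independent_or_poly (ltn0Sn 0) a0 cx x_neq0 hf f0) => [/(_ _ (key x))/back//|].
case: (independent_or_poly (ltn0Sn 0) a0 cy y_neq0 hf f0) => [/(_ _ (key y))/back//|].
move=> [m [h2 [_ p2 e2]]] [m' [h1 [_ p1 e1]]].
have ef : f = ev 0 0 h2.
  have fh1 : f = h1 by rewrite e1 (pure_evx _ p1).
  rewrite -fh1 in p1; rewrite -[LHS](pure_evx 0 p1) e2 ev_comp ev_y linear0.
  by [].
have [k lt|lef _] := top_ev (n := 0) (a := h2) (@deg_le0 0) (@deg_le0 0).
  by apply: proj_none => i j; apply/eqP; lia.
by case/eqP: f0; rewrite -hf ef lef.
Qed.

Lemma top_poly f (a : nat) m h : (0 < a)%N -> has_top a f -> pure (fun i => i <= m)%N h ->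
  deg_le (m * a) (ev f 0 h) /\
  cmp (m * a) (ev f 0 h) = ev (cmp a f) 0 (cmp m h).
Proof.
move=> a0 [fa _] hh.
have [k lt|lew ->] := @top_ev f 0 a 0 (m * a) h fa (@deg_le0 0).
  rewrite -hh /wcmp proj_proj; apply: proj_none => i j.
  by apply/negP => /andP[/eqP e /andP[le _]]; nia.
split=> //; rewrite linear0; congr ev; rewrite -hh /cmp /wcmp !proj_proj.
apply: proj_eq => i j; apply/andP/andP => -[/eqP e /andP[le /eqP ej]];
  by rewrite le ej eqxx; split=> //; apply/eqP; nia.
Qed.

Lemma top_poly_neq0 f (a : nat) m h : (0 < a)%N -> has_top a f ->
  pure (fun i => i <= m)%N h -> cmp m h != 0 -> has_top (m * a) (ev f 0 h).
Proof.
move=> a0 fa hh hm; have [le e] := top_poly a0 fa hh; split=> //; rewrite e.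
apply: contra hm => /eqP e0; apply/eqP.
have hf : cmp a (cmp a f) = cmp a f by rewrite cmp_cmp eqxx.
apply: (@homog_transcendental (cmp a f) a predT) e0 => //; first by case: fa.
rewrite /pure -hh /cmp /wcmp !proj_proj; apply: proj_eq => i j /=.
by case: (j == 0%N) => //=; rewrite !andbF.
Qed.

Lemma has_top_uniq (a b : nat) f : has_top a f -> has_top b f -> a = b.
Proof.
move=> [la na] [lb nb]; case: (ltngtP a b) => // lt.
  by rewrite la ?eqxx in nb.
by rewrite lb ?eqxx in na.
Qed.

Lemma has_top_ex f : f != 0 -> exists a : nat, has_top a f.
Proof. by move=> /(greatest_component 1 1) [a [h1 h2]]; exists a. Qed.

(** ** Automorphisms *)

Definition aut f g := bijective (ev f g).

Lemma aut_sym f g : aut f g -> aut g f.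
Proof.
move=> [phi h1 h2]; exists (ev y x \o phi) => a /=.
  by rewrite -[ev g f a](_ : ev f g (ev y x a) = _) ?h1 ev_comp ?ev_x ?ev_y ?ev_xy.
have -> : ev g f (ev y x (phi a)) = ev f g (phi a) by rewrite ev_comp ev_x ev_y.
exact: h2.
Qed.

(** The pair [(f, g + h(f))] is the composition of [(f, g)] with the elementary
    automorphism [(x, y + h(x))], whose inverse is [(x, y - h(x))]. *)
Lemma aut_shift (Q : pred nat) f g h : pure Q h -> aut f g -> aut f (g + ev f 0 h).
Proof.
move=> hh afg.
have e a : ev f (g + ev f 0 h) a = ev f g (ev x (y + h) a).
  by rewrite ev_comp ev_x linearD /= ev_y (pure_ev f g 0 hh).
have bij : bijective (ev x (y + h)).
  exists (ev x (y - h)) => a; rewrite ev_comp ev_x !linearD ?linearN /= ev_y.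
    by rewrite (pure_evx _ hh) subrK ev_xy.
  by rewrite (pure_evx _ hh) addrK ev_xy.
apply: (eq_bij (bij_comp afg bij)) => a.
by rewrite /= e.
Qed.

Lemma aut_has_top f g : aut f g -> exists2 a : nat, (0 < a)%N & has_top a f.
Proof.
move=> /bij_inj inj.
have nconst k : f != k *: naone.
  apply/negP => /eqP e; suff : (1 : K) = 0 by apply/eqP; exact: oner_neq0.
  have : x = k *: naone by apply: inj; rewrite ev_x linearZ /= ev_one.
  by rewrite -[x in LHS]scale1r -[_ *: x]addr0 -(scale0r y) => /xy_indep[].
have [|a ha] := @has_top_ex f.
  by apply/negP => /eqP e; have := nconst 0; rewrite e scale0r eqxx.
exists a => //; rewrite lt0n; apply/negP => /eqP a0.
case: ha; rewrite a0 => le _; have [k ek] := cmp0_const f.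
have /negP := nconst k; case; apply/eqP; rewrite -ek.
rewrite {1}[f](@wcmp_sum 1 1 1) ?big_nat1 // => l lt; exact: le.
Qed.

(** If the leading terms satisfied no relation, the leading term of [ev f g c] would
    be a nonzero value of a weighted component of [c].  For [ev f g c = x] this
    component has weight 1, so that it is a multiple of the first generator as
    [b > 1]; hence both [x] and [y] would be multiples of the leading term of [f]. *)
Lemma aut_top_dependent f g (a b : nat) : aut f g -> has_top a f -> has_top b g ->
  (0 < a)%N -> (a <= b)%N -> (1 < b)%N ->
  exists m h, [/\ b = (m * a)%N, pure (pred1 m) h & cmp b g = ev (cmp a f) 0 h].
Proof.
move=> afg [fa f0] [gb g0] a0 ab b1.
have hf : cmp a (cmp a f) = cmp a f by rewrite cmp_cmp eqxx.
have hg : cmp b (cmp b g) = cmp b g by rewrite cmp_cmp eqxx.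
case: (independent_or_poly a0 ab hf f0 hg g0) => // indep.
have lin (z : F) : z != 0 -> cmp 1 z = z -> exists k, z = k *: cmp a f.
  move=> z0 hz; have [phi _ h2] := afg; set c := phi z.
  have ec : ev f g c = z by apply: h2.
  have c0 : c != 0.
    by apply/negP => /eqP c0; rewrite -ec c0 linear0 eqxx in z0.
  have [n [cn cn0]] := greatest_component a b c0.
  have [_] := top_ev fa gb cn; rewrite ec => e.
  have n1 : n = 1%N.
    case: (n =P 1%N) => // ne; case/negP: cn0; apply/eqP/indep; rewrite -e -hz cmp_cmp.
    by case: eqP.
  rewrite n1 hz in e.
  (* A word of weight 1 in letters of weights [a >= 1] and [b > 1] is the letter [x]. *)
  have [k ek] : exists k, wcmp a b 1 c = k *: x.
    apply/pure_linear/pure_wspan; apply: wspanS (proj_wspan _ _) => w /eqP e1.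
    have d1 : deg1 w = 0%N by case: (deg1 w) e1 => // j; nia.
    by rewrite d1 muln0 addn0 in e1; rewrite d1 andbT; apply/eqP; nia.
  by exists k; rewrite e ek linearZ /= ev_x.
have [|k ex] := lin x x_neq0; first by rewrite cmp_x.
have [|l ey] := lin y y_neq0; first by rewrite cmp_y.
have [|l0 k0] := @xy_indep l (- k) 0.
  by rewrite ex ey !scalerA -scalerDl mulNr mulrC subrr !scale0r.
by move: x_neq0; rewrite ex -[k]opprK k0 oppr0 scale0r eqxx.
Qed.

(** ** Reduction of automorphisms *)

Lemma top_pure1 n h : pure (pred1 n) h -> cmp n h = h.
Proof.
move=> hh; rewrite -hh /cmp /wcmp proj_proj; apply: proj_eq => i j.
by rewrite /=; lia.
Qed.

Lemma pure_deg_leI (Q : pred nat) m h : pure Q h -> deg_le m h ->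
  pure (fun i => Q i && (i <= m)%N) h.
Proof.
move=> hh hm; rewrite [h](@wcmp_sum 1 1 m.+1) //.
rewrite big_nat; apply: big_ind => [||k /andP[_ lt]]; [exact: pure0|exact: pureD|].
rewrite -{1}hh /pure /wcmp !proj_proj; apply: proj_eq => i j.
case: (Q i) => /=; lia.
Qed.

(** Constant and linear terms are excluded because adding them does not raise the
    degree above that of [f]; this makes the decomposition in [aut_reduce] unique. *)
Definition top_tail m : set F :=
  [set h | pure (fun i => 1 < i <= m)%N h /\ cmp m h != 0].

Lemma deg_leB n a b : deg_le n a -> deg_le n b -> deg_le n (a - b).
Proof. by move=> ha hb k lt; rewrite linearB /= ha // hb // subr0. Qed.

Lemma aut_shiftN (Q : pred nat) f g h : pure Q h -> aut f g -> aut f (g - ev f 0 h).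
Proof.
move=> hh; rewrite -linearN /=; apply: aut_shift.
by rewrite -scaleN1r; apply: pureZ hh.
Qed.

Lemma aut_reduce1 f g (a b : nat) : aut f g -> has_top a f -> has_top b g ->
  (0 < a)%N -> (a <= b)%N -> (1 < b)%N ->
  exists m h, [/\ b = (m * a)%N, pure (pred1 m) h, h != 0 &
    aut f (g - ev f 0 h) /\ forall k, (b <= k)%N -> cmp k (g - ev f 0 h) = 0].
Proof.
move=> afg fa gb a0 ab b1.
have [m [h [eb hh e]]] := aut_top_dependent afg fa gb a0 ab b1.
have hm : pure (fun i => i <= m)%N h by apply: pureS hh => i /eqP ->.
have [le ee] := top_poly a0 fa hm.
exists m, h; split=> //.
  apply/negP => /eqP h0; case: gb => _ /negP; case.
  by rewrite e h0 linear0.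
split; first exact: aut_shiftN hh afg.
move=> k; rewrite leq_eqVlt linearB /= => /orP[/eqP <-|lt].
  by rewrite {2}eb ee (top_pure1 hh) e subrr.
by rewrite gb.1 // le -?eb // subr0.
Qed.

(** The leading terms of [g] are removed one after the other, as long as the degree
    exceeds that of [f]; as each of them is [h(f)] with [h] of degree greater than 1,
    linear terms never occur. *)
Lemma aut_reduce f g (a b : nat) : aut f g -> has_top a f -> has_top b g ->
  (a < b)%N -> exists m h, [/\ (1 < m)%N, b = (m * a)%N, top_tail m h,
    aut f (g - ev f 0 h) & deg_le a (g - ev f 0 h)].
Proof.
move=> afg fa gb ab.
have a0 : (0 < a)%N.
  by have [a' a'0 fa'] := aut_has_top afg; rewrite (has_top_uniq fa fa').
have [h [hh [ah le]]] : exists h, pure (fun i => 1 < i)%N h /\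
    (aut f (g - ev f 0 h) /\ deg_le a (g - ev f 0 h)).
  have [n ltn] := ubnP b; elim: n => // n ih in b g afg gb ab ltn *.
  have [m [h0 [eb hh _ [ah ch]]]] :=
    aut_reduce1 afg fa gb a0 (ltnW ab) (leq_ltn_trans a0 ab).
  have m1 : (1 < m)%N by move: ab; rewrite eb; case: m {eb hh} => [|[|]] //; lia.
  have hh' : pure (fun i => 1 < i)%N h0 by apply: pureS hh => i /eqP ->.
  have [b' _ gb'] := aut_has_top (aut_sym ah).
  have ltb : (b' < b)%N by rewrite ltnNge; apply/negP => /ch e; case: gb'; rewrite e eqxx.
  have [leb'|ltb'] := leqP b' a.
    by exists h0; split=> //; split=> //; apply: deg_le_leq leb' gb'.1.
  have [h1 [hh1 [ah1 le1]]] := ih b' _ ah gb' ltb' (leq_trans ltb ltn).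
  exists (h0 + h1); split; first exact: pureD.
  by rewrite linearD /= opprD addrA.
have hn0 : h != 0.
  apply/negP => /eqP h0; move: le; rewrite h0 linear0 subr0 => /(_ _ ab) e.
  by case: gb; rewrite e eqxx.
have [m [lem hm]] := has_top_ex hn0.
have hmp := pure_deg_leI hh lem.
have m1 : (1 < m)%N.
  rewrite ltnNge; apply: contra hm => m1; rewrite -hh /cmp /wcmp proj_proj.
  by apply/eqP/proj_none => i j; apply/negP => /andP[/eqP e /andP[i1 /eqP j0]]; lia.
have hmp' : pure (fun i => i <= m)%N h by apply: pureS hmp => i /andP[].
exists m, h; split=> //.
apply: has_top_uniq gb _; rewrite -[g](subrK (ev f 0 h)).
have [le2 ne2] := top_poly_neq0 a0 fa hmp' hm.
have lt : (a < m * a)%N by rewrite ltn_Pmull.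
split; last by rewrite linearD /= le // add0r.
by move=> k ltk; rewrite linearD /= le ?(ltn_trans lt ltk) // le2 // addr0.
Qed.

(** ** Counting automorphisms *)

(* Finiteness of the field enters through the cardinalities in [hq], [hc], [hgl]. *)
Variables (q : nat) (c : nat -> nat).
Hypothesis hq : ncard [set: K] q.
Hypothesis hc : forall n, ncard (homog (fun _ : unit => x) n) (q ^ c n).

Local Notation tails := (tails q c).

Lemma ncard_monomials m : ncard (pure (pred1 m)) (q ^ c m).
Proof. by apply: ncard_eq (hc m) => h; apply: homog_pure. Qed.

Lemma pure_split (P Q : pred nat) h : (forall i, ~~ (P i && Q i)) ->
  pure (fun i => P i || Q i) h ->
  h = proj (fun i j => P i && (j == 0%N)) h + proj (fun i j => Q i && (j == 0%N)) h.
Proof.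
move=> dis hh; rewrite -proj_orb => [|i j].
  by rewrite -{1}hh; apply: proj_eq => i j; rewrite andb_orl.
by apply: contra (dis i) => /andP[/andP[-> _] /andP[-> _]].
Qed.

Lemma pure_proj (Q : pred nat) h : pure Q (proj (fun i j => Q i && (j == 0%N)) h).
Proof. by rewrite /pure proj_proj; apply: proj_eq => i j; rewrite andbb. Qed.

(** Splitting off the term of degree [m]. *)
Lemma ncard_tail_sum m (A : set F) n : (1 < m)%N ->
  (forall h, A h -> pure (pred1 m) h) -> forall k,
  ncard (pure (fun i => 1 < i < m)%N) k -> ncard A n ->
  ncard (fun h => pure (fun i => 1 < i <= m)%N h /\ A (cmp m h)) (k * n).
Proof.
move=> m1 hA k hk hn.
have cm h : pure (fun i => 1 < i < m)%N h -> cmp m h = 0.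
  move=> hh; rewrite -hh /cmp /wcmp proj_proj; apply: proj_none => i j.
  by apply/negP => /andP[/eqP e /andP[i1 /eqP j0]]; lia.
apply: (ncard_bij (f := fun t : F * F => t.1 + t.2)) (ncard_prod hk hn).
- move=> [h1 h2] /= [p1 p2]; have p2' := hA _ p2.
  rewrite linearD /= cm // (top_pure1 p2') add0r; split=> //.
  apply: pureD; [apply: pureS p1|apply: pureS p2'] => i.
    by move=> /andP[-> /ltnW].
  by move=> /eqP ->; rewrite m1 leqnn.
- move=> [h1 h2] [h1' h2'] /= [p1 /hA p2] [p1' /hA p2'] e.
  have := congr1 (cmp m) e; rewrite !linearD /= (cm _ p1) (cm _ p1') (top_pure1 p2) (top_pure1 p2').
  rewrite !add0r => e2.
  by move: e; rewrite e2 => /addIr ->.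
move=> h [hh Ah].
have eh : h = proj (fun i j => (1 < i < m) && (j == 0))%N h +
    proj (fun i j => (i == m) && (j == 0%N)) h.
  apply: (@pure_split (fun i => 1 < i < m)%N (pred1 m)) => [i|].
    by apply/negP => /andP[/andP[_ lt] /eqP e]; rewrite e ltnn in lt.
  by apply: pureS hh => i; rewrite /= leq_eqVlt; lia.
have p1 := pure_proj (fun i => 1 < i < m)%N h.
have p2 := pure_proj (pred1 m) h.
have em : cmp m h = proj (fun i j => (i == m) && (j == 0%N)) h.
  by rewrite {1}eh linearD /= cm // add0r; apply: top_pure1.
by exists (proj (fun i j => (1 < i < m) && (j == 0))%N h, cmp m h); last by rewrite /= em -eh.
Qed.

Lemma ncard_low_tails m :
  ncard (pure (fun i => 1 < i < m)%N) (q ^ (\sum_(2 <= j < m) c j)).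
Proof.
have base k : (k <= 2)%N -> ncard (pure (fun i => 1 < i < k)%N) (q ^ (\sum_(2 <= j < k) c j)).
  move=> k2; rewrite big_geq // expn0; exists [:: 0]; split=> // h.
  rewrite inE; split=> [<-|/eqP ->]; last exact: pure0.
  by apply/eqP/proj_none => i j; apply/negP => /andP[/andP[]]; lia.
elim: m => [|m ih]; first exact: base.
case: (leqP m 1) => [m1|m1]; first exact: base.
rewrite big_nat_recr //= expnD.
apply: ncard_eq (ncard_tail_sum m1 (fun h hh => hh) ih (ncard_monomials m)) => h.
split=> [[hh _]|hh]; first by apply: pureS hh => i; rewrite ltnS.
split; first by apply: pureS hh => i; rewrite ltnS.
rewrite /pure -{1}hh /cmp /wcmp !proj_proj -[in RHS]hh !proj_proj; apply: proj_eq => i j.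
by rewrite /=; lia.
Qed.

Lemma ncard_tails m : (1 < m)%N -> ncard (top_tail m) (tails m).
Proof.
move=> m1; rewrite /tails mulnC.
have := ncard_tail_sum (A := fun h => pure (pred1 m) h /\ h != 0) m1 _
   (ncard_low_tails m) (ncardD1 (pure0 _) (ncard_monomials m)).
move=> /(_ (fun h => @proj1 _ _)); apply: ncard_eq => h; rewrite /top_tail /=.
split=> [[hh [_ h0]]|[hh h0]] //; split=> //; split=> //.
rewrite /pure -{1}hh /cmp /wcmp !proj_proj -[in RHS]hh !proj_proj; apply: proj_eq => i j.
by rewrite /=; lia.
Qed.


(** In these classes the pair [(f, g)] stands for the automorphism [ev f g].  The
    recursion alternates between [aut_low2], where the first component has the largest
    degree, and [aut_lt1], where the second one has the strictly largest degree. *)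
Definition aut_degs (a b : nat) : set (F * F) :=
  [set t | [/\ aut t.1 t.2, has_top a t.1 & has_top b t.2]].
Definition aut_low2 n : set (F * F) :=
  [set t | [/\ aut t.1 t.2, has_top n t.1 & deg_le n t.2]].
Definition aut_lt1 n : set (F * F) :=
  [set t | exists2 a : nat, (a < n)%N & aut_degs a n t].
Definition aut_deg n : set (F * F) :=
  [set t | exists a b : nat, aut_degs a b t /\ n = maxn a b].

Lemma aut_degs_gt0 (a b : nat) t : aut_degs a b t -> (0 < a)%N /\ (0 < b)%N.
Proof.
move=> [at1 h1 h2]; have [a' a'0 ha] := aut_has_top at1.
have [b' b'0 hb] := aut_has_top (aut_sym at1).
by rewrite (has_top_uniq h1 ha) (has_top_uniq h2 hb).
Qed.

(** By [aut_reduce] the map [(h, (f, g)) -> (f, g + h(f))] is onto.  It is injective: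
    if [h] and [h'] differ, then [(h - h')(f)] has degree at least [2 * a], while
    [g' - g] has degree at most [a]. *)
Lemma ncard_aut_degs (a b : nat) k : (a < b)%N -> ncard (aut_low2 a) k ->
  ncard (aut_degs a b) (if (a %| b)%N then tails (b %/ a) * k else 0)%N.
Proof.
move=> ab hk; case: ifP => dv; last first.
  apply: ncard_empty => -[f g] /= [afg fa gb].
  have [m [h [_ eb _ _ _]]] := aut_reduce afg fa gb ab.
  by rewrite eb dvdn_mull in dv.
have [a0|a0] := posnP a.
  by move: dv ab; rewrite a0 dvd0n => /eqP ->.
have eb := divnK dv; set m := (b %/ a)%N in eb *.
have m1 : (1 < m)%N by move: ab; rewrite -eb; case: (m) => [|[|]] //; lia.
have tail_le h : top_tail m h -> pure (fun i => i <= m)%N h.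
  by move=> [hh _]; apply: pureS hh => i /andP[].
apply: (ncard_bij (f := fun t : F * (F * F) => (t.2.1, t.2.2 + ev t.2.1 0 t.1)))
  (ncard_prod (ncard_tails m1) hk).
- move=> [h [f g]] /= [hh [/= afg fa ga]].
  split=> //=; first exact: aut_shift hh.1 afg.
  have [le ne] := top_poly_neq0 a0 fa (tail_le _ hh) hh.2; rewrite -eb.
  have lt : (a < m * a)%N by rewrite ltn_Pmull.
  split; last by rewrite linearD /= ga // add0r.
  by move=> l ltl; rewrite linearD /= ga ?(ltn_trans lt ltl) // le // addr0.
- move=> [h [f g]] [h' [f' g']] /= [hh [/= afg fa ga]] [hh' [/= _ _ ga']] [ef].
  rewrite -ef => e; have e2 : ev f 0 (h - h') = g' - g.
    by apply: (addrI g); rewrite linearB /= addrA e addrK addrC subrK.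
  have [e0|ne] := eqVneq (h - h') 0.
    have eh : h = h' by apply/eqP; rewrite -subr_eq0 e0.
    by rewrite eh in e *; rewrite (addIr _ e).
  have [k' tk] := has_top_ex ne.
  have pb : pure (fun i => 1 < i)%N (h - h').
    rewrite -scaleN1r addrC; apply: pure_lin.
      by apply: pureS hh'.1 => i /andP[].
    by apply: pureS hh.1 => i /andP[].
  have pk := pure_deg_leI pb tk.1.
  have k1 : (1 < k')%N.
    rewrite ltnNge; apply/negP => k1; case: tk => _ /negP; case; apply/eqP.
    by rewrite -pk /cmp /wcmp proj_proj; apply: proj_none => i j; lia.
  have pk' : pure (fun i => i <= k')%N (h - h') by apply: pureS pk => i /andP[].
  have [_] := top_poly_neq0 a0 fa pk' tk.2; rewrite e2.
  by rewrite (deg_leB ga' ga) ?eqxx // ltn_Pmull.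
- move=> [f g] [/= afg fa gb].
  have [m' [h [_ eb' hh ah le]]] := aut_reduce afg fa gb ab.
  have em : m' = m by apply/eqP; rewrite -(eqn_pmul2r a0) -eb' eb.
  rewrite em in hh.
  by exists (h, (f, g - ev f 0 h)); rewrite //= subrK.
Qed.

Lemma ncard_aut_lt1 n (k : nat -> nat) : (0 < n)%N ->
  (forall a : nat, 0 < a < n -> ncard (aut_low2 a) (k a))%N ->
  ncard (aut_lt1 n) (\sum_(a <- divisors n | a < n) tails (n %/ a) * k a)%N.
Proof.
move=> n0 hk; rewrite big_proper_divisors //; apply: ncard_bigU => [a lt|a a' t [_ h _] [_ h' _]]; last first.
  exact: has_top_uniq h h'.
have [a0|a0] := posnP a.
  by apply: ncard_empty => t /aut_degs_gt0; rewrite a0 => -[].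
by rewrite /=; apply: ncard_aut_degs => //; apply: hk; rewrite a0.
Qed.

(** The map [(l, (f, g)) -> (g, f + l g)] is a bijection: when both components have
    degree [n], their leading terms are proportional, with a unique factor [l]. *)
Lemma ncard_aut_low2 n k : (1 < n)%N -> ncard (aut_lt1 n) k ->
  ncard (aut_low2 n) (q * k).
Proof.
move=> n1 hk; have n0 := ltnW n1.
apply: (ncard_bij (f := fun t : K * (F * F) => (t.2.2, t.2.1 + t.1 *: t.2.2)))
  (ncard_prod hq hk).
- move=> [l [f g]] /= [_ [a lt [/= afg fa ga]]].
  split=> //=; last first.
    rewrite addrC; apply: deg_le_lin; first exact: ga.1.
    by apply: deg_le_leq fa.1; apply: ltnW.
  have := @aut_shift predT _ _ (l *: x) (pureZ _ (pure_x isT)) (aut_sym afg).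
  by rewrite linearZ /= ev_x.
- move=> [l [f g]] [l' [f' g']] /= [_ [a lt [/= _ fa ga]]] [_ [a' lt' [/= _ fa' _]]] [eg].
  rewrite -eg => e; suff el : l = l'.
    by rewrite el in e *; rewrite (addIr _ e).
  have := congr1 (cmp n) e; rewrite !linearD !linearZ /= fa.1 // fa'.1 // !add0r.
  move=> /eqP; rewrite -subr_eq0 -scalerBl scaler_eq0 (negPf ga.2) orbF subr_eq0.
  by move=> /eqP.
move=> [f g] [/= afg fn gn]; have [b b0 gb] := aut_has_top (aut_sym afg).
have [bn|] := ltnP b n.
  exists (0, (g, f)); last by rewrite /= scale0r addr0.
  by split=> //; exists b => //; split=> //; apply: aut_sym.
move=> nb; have eb : b = n.
  apply/eqP; rewrite eqn_leq nb andbT leqNgt; apply/negP => lt.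
  by case: gb => _; rewrite gn // eqxx.
rewrite eb in gb.
have [m [h [en hh _ [ah ch]]]] := aut_reduce1 afg fn gb n0 (leqnn n) n1.
have m1 : m = 1%N by nia.
rewrite m1 in hh; have [l el] := pure_linear hh.
rewrite el linearZ /= ev_x in ah ch.
exists (l, (g - l *: f, f)); last by rewrite /= subrK.
split=> //=; have [b' b'0 gb'] := aut_has_top (aut_sym ah).
exists b'; first by rewrite ltnNge; apply/negP => /ch e; case: gb'; rewrite e eqxx.
by split=> //; apply: aut_sym.
Qed.

Lemma ncard_aut_deg n k l : ncard (aut_low2 n) k -> ncard (aut_lt1 n) l ->
  ncard (aut_deg n) (k + l).
Proof.
move=> hk hl; apply: ncard_eq (ncardU _ hk hl) => [[f g]|[f g]] /=.
  split=> [[[/= afg fn gn]|[a lt [/= afg fa gn]]]|[a [b [[/= afg fa gb] en]]]].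
  - have [b b0 gb] := aut_has_top (aut_sym afg).
    exists n, b; split=> //; apply/esym/maxn_idPl; rewrite leqNgt; apply/negP => lt.
    by case: gb => _; rewrite gn // eqxx.
  - by exists a, n; split=> //; apply/esym/maxn_idPr/ltnW.
  - rewrite en; have [le|lt] := leqP b a; [left|right].
      by split=> //=; apply: deg_le_leq gb.1.
    by exists a.
move=> [/= _ fn _] [a lt [/= _ fa _]].
by rewrite (has_top_uniq fa fn) ltnn in lt.
Qed.

(** ** Affine automorphisms *)

Variable gl : nat.
Hypothesis hgl :
  ncard (fun v : K * K * (K * K) => v.1.1 * v.2.2 - v.1.2 * v.2.1 != 0) gl.

Definition nconst := if u then q else 1%N.

Lemma ncard_const : ncard (fun a : F => exists k, a = k *: naone) nconst.
Proof.
case: (naone_unit_or_0 F) => [[u1 [l1 _]]|[u0 e0]].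
  have -> : nconst = q.
    rewrite /nconst; have -> : u = true.
      by apply/negPn/negP => /negPf u0; move/eqP: u1; rewrite u0 eq_sym oner_eq0.
    by [].
  apply: (ncard_bij (f := fun k : K => k *: (naone : F))) hq => [k _|k l _ _ e|a [k ->]].
  - by exists k.
  - have : (k - l) *: x = 0 by rewrite -(l1 x) -namulZl scalerBl e subrr namul0r.
    by move/eqP; rewrite scaler_eq0 (negPf x_neq0) orbF subr_eq0 => /eqP.
  - by exists k.
have -> : nconst = 1%N.
  rewrite /nconst; have -> : u = false.
    by apply/negP => u1; move/eqP: u0; rewrite u1 oner_eq0.
  by [].
exists [:: 0]; split=> // a; rewrite inE; split=> [[k ->]|/eqP ->].
  by rewrite e0 scaler0.
by exists 0; rewrite scale0r.
Qed.

Lemma const_pure k : pure (pred1 0%N) (k *: naone).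
Proof. by apply: pureZ; rewrite /pure proj_one. Qed.

Lemma cmp1_affine k l a : (exists m, a = m *: naone) ->
  deg_le 1 (k *: x + l *: y + a) /\ cmp 1 (k *: x + l *: y + a) = k *: x + l *: y.
Proof.
move=> [m ->]; split=> [i i1|].
  rewrite !(linearD, linearZ) /= cmp_x cmp_y cmp_one.
  by case: i i1 => [|[|]] // i _; rewrite !scaler0 !addr0.
by rewrite !(linearD, linearZ) /= cmp_x cmp_y cmp_one scaler0 addr0.
Qed.

Lemma affine_decomp f : deg_le 1 f -> f = cmp 1 f + cmp 0 f.
Proof.
move=> h; rewrite [LHS](@wcmp_sum 1 1 2) //.
by rewrite big_nat_recr //= big_nat1 addrC.
Qed.

Lemma lin_eq k l k' l' : k *: x + l *: y = k' *: x + l' *: y -> k = k' /\ l = l'.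
Proof.
move=> e; have [|/eqP h /eqP h'] := @xy_indep (k - k') (l - l') 0.
  by rewrite !scalerBl addrACA e -opprD subrr scale0r.
by move: h h'; rewrite !subr_eq0 => /eqP -> /eqP ->.
Qed.

(** An affine pair is an automorphism exactly when the determinant of its linear part
    is nonzero: otherwise a nontrivial combination of [f] and [g] is constant, and
    then so is the same combination of [x] and [y]. *)
Lemma ncard_affine : ncard (aut_low2 1) (gl * (nconst * nconst)).
Proof.
have lin_neq0 k l : k *: x + l *: y = 0 -> k = 0 /\ l = 0.
  by move=> e; apply: (@xy_indep k l 0); rewrite e scale0r.
apply: (ncard_bij (f := fun t : (K * K * (K * K)) * (F * F) =>
   (t.1.1.1 *: x + t.1.1.2 *: y + t.2.1, t.1.2.1 *: x + t.1.2.2 *: y + t.2.2)))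
  (ncard_prod hgl (ncard_prod ncard_const ncard_const)).
- move=> [[[k l] [m n]] [a b]] /= [d [ca cb]].
  have [lea ea] := cmp1_affine k l ca; have [leb eb] := cmp1_affine m n cb.
  split=> //=; last first.
    split=> //; rewrite ea; apply/negP => /eqP /lin_neq0 [k0 l0].
    by rewrite k0 l0 !mul0r subrr eqxx in d.
  have add_const f g z : (exists k', z = k' *: naone) -> aut f g -> aut f (g + z).
    move=> [k' ->] /(aut_shift (const_pure k')).
    by rewrite linearZ /= ev_one.
  by apply: (add_const _ _ _ cb); apply/aut_sym/(add_const _ _ _ ca)/aut_sym/ev_lin_bij.
- move=> [[[k l] [m n]] [a b]] [[[k' l'] [m' n']] [a' b']] /= [_ [ca cb]] [_ [ca' cb']].
  move=> [e1 e2].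
  have := congr1 (cmp 1) e1; rewrite (cmp1_affine k l ca).2 (cmp1_affine k' l' ca').2.
  move=> /lin_eq[ek el]; rewrite ek el in e1 *.
  have := congr1 (cmp 1) e2; rewrite (cmp1_affine m n cb).2 (cmp1_affine m' n' cb').2.
  move=> /lin_eq[em en]; rewrite em en in e2 *.
  by rewrite (addrI _ e1) (addrI _ e2).
move=> [f g] [/= afg f1 g1].
have [k [l ef]] := cmp1_lin f; have [m [n eg]] := cmp1_lin g.
exists (((k, l), (m, n)), (cmp 0 f, cmp 0 g)); last first.
  by rewrite /= -ef -eg -(affine_decomp f1.1) -(affine_decomp g1).
split=> /=; last by split; apply: cmp0_const.
have no_rel i j : i *: cmp 1 f + j *: cmp 1 g = 0 -> i = 0 /\ j = 0.
  move=> e; have [r er] := cmp0_const (i *: f + j *: g).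
  apply: (@xy_indep i j r); apply: (bij_inj afg).
  rewrite linearD !linearZ /= ev_x ev_y ev_one -er.
  rewrite {1}(affine_decomp f1.1) {1}(affine_decomp g1) !scalerDr addrACA e add0r.
  by rewrite linearD !linearZ.
apply/negP => /eqP d0; have d1 : k * n = l * m by apply/eqP; rewrite -subr_eq0 d0.
have [|n0 /eqP] := no_rel n (- l).
  rewrite ef eg !scalerDr !scalerA addrACA -!scalerDl mulrC d1 !mulNr.
  by rewrite subrr [n * l]mulrC subrr !scale0r addr0.
rewrite oppr_eq0 => /eqP l0.
have [|m0 /eqP] := no_rel m (- k).
  rewrite ef eg l0 n0 !scale0r !addr0 !scalerA -scalerDl mulNr [m * k]mulrC.
  by rewrite subrr scale0r.
rewrite oppr_eq0 => /eqP k0.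
by case: f1 => _; rewrite ef k0 l0 !scale0r addr0 eqxx.
Qed.


(** ** Automorphisms of given degree *)

(** The sizes of both classes obey the recursion [factorization_sum_rec]: one sums over
    the degree [a] of the smaller component, a proper divisor of [n]. *)
Lemma ncard_aut_low2_weight p1 n : ncard (aut_low2 1) p1 -> (0 < n)%N ->
  ncard (aut_low2 n) (p1 * weight q c n) /\
  ((1 < n)%N -> ncard (aut_lt1 n) (p1 * factorization_sum q c n)).
Proof.
move=> h1; have [N ltN] := ubnP n; elim: N => // N ih in n ltN *; move=> n0.
have lt1 : (1 < n)%N -> ncard (aut_lt1 n) (p1 * factorization_sum q c n).
  move=> n1; rewrite factorization_sum_rec // big_distrr /=.
  under eq_bigr do rewrite mulnCA.
  apply: (@ncard_aut_lt1 n (fun a : nat => p1 * weight q c a)%N) => // a /andP[a0 lt].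
  by apply: (ih a _ a0).1; lia.
split=> //; have [n1|n1] := ltnP 1 n; last first.
  have -> : n = 1%N by lia.
  by rewrite /weight factorization_sum1 muln0 addn0 muln1.
rewrite /weight (gtn_eqF n1) add0n mulnCA.
exact: ncard_aut_low2 (lt1 n1).
Qed.

(** ** Degrees in terms of the defining words *)

Lemma homog_cmp n (a : F) : homog G n a <-> cmp n a = a.
Proof.
rewrite -[homog _ n]/(wspan G (fun w => wdeg w == n)) /cmp /wcmp -wspan_proj.
by split; apply: wspanS => w; rewrite -/(wt 1 1 w) wt11.
Qed.

Lemma has_degP n (a : F) : has_deg G a n <-> has_top n a.
Proof.
split=> [[b [hb ea bn]]|[le an]].
  have comp k : cmp k a = if (k <= n)%N then b k else 0.
    rewrite ea linear_sum /= -ltnS; case: ifP => [lt|ge].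
      rewrite (bigD1 (Ordinal lt)) //= big1 ?addr0 => [|i ne].
        by apply/homog_cmp.
      have /homog_cmp <- := hb i; rewrite cmp_cmp; case: eqP => // e.
      by case/eqP: ne; apply: val_inj.
    rewrite big1 // => i _; have /homog_cmp <- := hb i; rewrite cmp_cmp.
    by case: eqP => // e; rewrite e ltn_ord in ge.
  split=> [k lt|]; first by rewrite comp leqNgt lt.
  by rewrite comp leqnn.
exists (fun k => cmp k a); split=> // [i|].
  by apply/homog_cmp; rewrite cmp_cmp eqxx.
by rewrite [LHS](@wcmp_sum 1 1 n.+1) // big_mkord.
Qed.

Lemma automorphisms_card n k : ncard (aut_deg n) k ->
  (automorphisms_of_degree x y n #= `I_k)%card.
Proof.
move=> [s [us <- hs]]; apply/card_set_bijP.
have evP (phi : F -> F) : is_hom phi -> phi = ev (phi x) (phi y).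
  by move=> hphi; apply: funext; apply: ev_uniq.
have mem (phi : F -> F) : automorphisms_of_degree x y n phi -> (phi x, phi y) \in s.
  move=> [[hphi bphi] [a [b [fa gb en]]]].
  apply/hs; exists a, b; split=> //; split; try exact/has_degP.
  by rewrite /= /aut -evP.
exists (fun phi : F -> F => index (phi x, phi y) s); split.
- by move=> phi /mem; rewrite /= index_mem.
- move=> phi psi; rewrite !inE => hphi hpsi e.
  have := congr1 (nth (0, 0) s) e; rewrite !nth_index ?mem // => -[ex ey].
  rewrite (evP _ hphi.1.1) (evP _ hpsi.1.1).
  by rewrite ex ey.
move=> i /= lt; have /hs [a [b [[afg fa gb] en]]] := mem_nth (0, 0) lt.
exists (ev (nth (0, 0) s i).1 (nth (0, 0) s i).2).
  split; first by split; [exact: ev_hom|exact: afg].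
  by exists a, b; rewrite ev_x ev_y; split=> //; apply/has_degP.
by rewrite ev_x ev_y -surjective_pairing index_uniq.
Qed.
End TwoGenerators.

Theorem theorem3p1 (q : nat) (K : finFieldType) (hq : #|K| = q) (u : bool)
    (E : set (napoly K nat)) (hE : homogeneous_system E)
    (hNS : nielsen_schreier u E)
    (F : naAlgType u K) (x y : F) (hF : free_on E (pair_gen x y))
    (hgr : multigraded (pair_gen x y))
    (hF0 : exists a : F, a != 0)
    (c : nat -> nat)
    (hc : forall n : nat, has_dim (homog (fun _ : unit => x) n) (c n)) :
  exists p : nat -> nat,
    [/\ forall n : nat, (0 < n)%N ->
          (automorphisms_of_degree x y n #= `I_(p n))%card,
        p 1%N = (if u then q ^ 3 * (q - 1) ^ 2 * (q + 1)
                 else q * (q - 1) ^ 2 * (q + 1))%N,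
        forall n : nat, (1 < n)%N ->
          p n = (p 1 * (q + 1) * factorization_sum q c n)%N
      & exists2 w : dseries,
          is_dquot (dconst (q + 1)%N%:R)
            (dsub (dconst 1) (dmul (dconst q%:R) (dsigma q c))) w
          & deq (fun n => (p n)%:R)
              (dmul (dconst ((p 1%N)%:R / q%:R)) (dsub w (dconst 1)))].
Proof.
have q0 : (0 < q)%N by rewrite -hq; apply/card_gt0P; exists 0.
have nK : ncard [set: K] q.
  by rewrite -hq; apply: ncard_eq (ncard_fin predT).
have nH n : ncard (homog (fun _ : unit => x) n) (q ^ c n).
  by rewrite -hq; apply: ncard_has_dim (hc n).
have nGL := ncard_det2 K; rewrite hq in nGL.
pose p1 := (q * (q - 1) ^ 2 * (q + 1) * (nconst u q * nconst u q))%N.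
have n1 := ncard_affine hF hgr hF0 nK nGL; rewrite -/p1 in n1.
have count n := ncard_aut_low2_weight hgr hF0 hNS nK nH n1 (n := n).
exists (fun n => if n == 1%N then p1 else p1 * (q + 1) * factorization_sum q c n)%N.
split=> /= [n n0||n ngt1|].
- apply: (automorphisms_card (hF := hF) hgr).
  case: eqP => [->|/eqP ne].
    rewrite -[p1]addn0; apply: (ncard_aut_deg hgr hF0 n1).
    apply: ncard_empty => t [a a1 /(aut_degs_gt0 hgr hF0)[a0 _]].
    by rewrite ltnNge a0 in a1.
  have ngt1 : (1 < n)%N by lia.
  have [h1 /(_ ngt1) h2] := count n n0.
  have := ncard_aut_deg hgr hF0 h1 h2; rewrite /weight (negPf ne) add0n.
  by rewrite -mulnDr -mulSnr -[in q.+1]addn1 mulnA.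
- by rewrite /p1 /nconst; case: (u); ring.
- by rewrite (gtn_eqF ngt1).
exists (fun n => (q + 1)%N%:R * (weight q c n)%:R); first exact: dirichlet_weight.
move=> n n0; rewrite dmul_dconst // /dsub /dconst /weight.
have qn0 : (q%:R : rat) != 0 by rewrite Num.Theory.pnatr_eq0 -lt0n.
case: eqP => [->|_].
  by rewrite factorization_sum1 muln0 addn0 mulr1 natrD addrK mulfVK.
by rewrite add0n subr0 !natrM; field.
Qed.
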